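(* Let $V$ be a finite-dimensional complex vector space, let $W^+,W^-$ be complex vector spaces, and let $\mathcal U^\pm\in\mathrm{Mer}(V\otimes W^\pm)$. Suppose there exists $R\in\mathrm{Mer}(V^{\otimes 2})^\times$ with $R^{t_1}\in\mathrm{Mer}(V^{\otimes 2})^\times$ such that, for generic $x,y\in\mathbb C$, the following two relations hold: (right reflection equation) in $\mathrm{End}(V_{(0)}\otimes V_{(0')}\otimes W^-_{(1)})$, $$R_{0'0}(x/y)\,\mathcal U^-_{01}(x)\,R_{00'}(xy)\,\mathcal U^-_{0'1}(y)=\mathcal U^-_{0'1}(y)\,R_{0'0}(xy)\,\mathcal U^-_{01}(x)\,R_{00'}(x/y);$$ (dual reflection equation) in $\mathrm{End}(V_{(0)}\otimes V_{(0')}\otimes W^+_{(1)})$, $$R_{0'0}(x/y)^{-t}\,\mathcal U^+_{01}(x)^{t_0}\,\tilde R_{00'}(xy)^{t}\,\mathcal U^+_{0'1}(y)^{t_{0'}}=\mathcal U^+_{0'1}(y)^{t_{0'}}\,\tilde R_{0'0}(xy)^{t}\,\mathcal U^+_{01}(x)^{t_0}\,R_{00'}(x/y)^{-t},$$ where $\tilde R(x):=((R(x)^{t_1})^{-1})^{t_1}$. Define $\mathcal T\in\mathrm{Mer}(W^+\otimes W^-)$ by $$\mathcal T_{12}(x)=\mathrm{Tr}_0\,\mathcal U^+_{01}(x)\,\mathcal U^-_{02}(x),$$ where the product inside the partial trace acts in $V_{(0)}\otimes W^+_{(1)}\otimes W^-_{(2)}$. Then $$[\mathcal T(x),\mathcal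 T(y)]=0\qquad\text{for all }x,y\in\mathrm{dom}(\mathcal T).$$
   Context: For a complex vector space $V$ (not necessarily finite-dimensional), $\mathrm{Mer}(V)\cong\mathrm{Mer}\otimes\mathrm{End}(V)$ is the algebra of meromorphic functions $\mathbb C\to\mathrm{End}(V)$, where $\mathrm{Mer}$ is the algebra of meromorphic functions $\mathbb C\to\mathbb C$; $\mathrm{Mer}(V)^\times$ is the set of those whose values are invertible for generic argument. $\mathrm{dom}(F)$ is the set of points at which the meromorphic function $F$ is defined (has no pole). ''For generic $x,y$'' means outside a proper analytic subset, i.e. as an identity of meromorphic functions. Tensor-leg notation: subscripts in parentheses label tensor factors, and the subscripts of an operator indicate in which labelled factors (and in which order) it acts, the operator acting as the identity in all other factors; thus $R_{21}=PR_{12}P$ with $P(v\otimes v')=v'\otimes v$. Here $0$ and $0'$ label two copies of $V$. $X^{t_i}$ and $\mathrm{Tr}_i X$ denote the partial transpose and partial trace of $X$ with respect to the finite-dimensional factor labelled $i$ (transposition is taken with respect to a fixed identification of $V$ with its dual, i.e. in a fixed basis). For an operator $X$ on $V\otimes V$, $X^t=(X^{t_1})^{t_2}$ is the full transpose and $X^{-t}=(X^{-1})^t$. $R^{t_1}$ denotes $x\mapsto R(x)^{t_1}$. *)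

(* Defs.v *)
From HB Require Import structures.
From mathcomp Require Import all_boot all_order all_algebra.
From mathcomp Require Import complex.
From mathcomp Require Import all_classical all_reals topology normedtype.
From mathcomp Require Import sequences.

Set Implicit Arguments.
Unset Strict Implicit.
Unset Printing Implicit Defensive.

Import Order.TTheory GRing.Theory Num.Theory.
Import numFieldTopology.Exports numFieldNormedType.Exports.

Local Open Scope classical_set_scope.
Local Open Scope quotient_scope.
Local Open Scope ring_scope.

(** * Tensor product of two (possibly infinite-dimensional) vector spaces

   Elements are classes of formal sums of pairs (the scalar of a term is
   absorbed in its first component).  Two formal sums represent the same
   tensor when every bilinear map into every vector space identifies them.
   The universal property is [tlift_linear], [tliftE] and [tlift_unique]. *)

Notation bilinear_map b := (bilinear_for *:%R *:%R b).

Section TensorProduct.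
Variables (K : fieldType) (U W : lmodType K).
Implicit Types s t : seq (U * W).

Definition tens_eqv s t : bool :=
  `[< forall (X : lmodType K) (b : U -> W -> X), bilinear_map b ->
        \sum_(p <- s) b p.1 p.2 = \sum_(p <- t) b p.1 p.2 >].

Lemma tens_eqv_refl : reflexive tens_eqv.
Proof. by move=> s; apply/asboolP. Qed.

Lemma tens_eqv_sym : symmetric tens_eqv.
Proof.
by move=> s t; apply/asboolP/asboolP => h X b hb; rewrite (h X b hb).
Qed.

Lemma tens_eqv_trans : transitive tens_eqv.
Proof.
move=> t s r /asboolP hst /asboolP htr; apply/asboolP => X b hb.
by rewrite (hst X b hb) (htr X b hb).
Qed.

Canonical tens_equiv :=
  EquivRel tens_eqv tens_eqv_refl tens_eqv_sym tens_eqv_trans.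

Definition tens : Type := {eq_quot tens_equiv}.

HB.instance Definition _ := Choice.on tens.
HB.instance Definition _ := EqQuotient.on tens.

Definition tpure (u : U) (w : W) : tens := \pi_tens [:: (u, w)].

(* The linear map induced by [b]; meaningful when [b] is bilinear. *)
Definition tlift (X : nmodType) (b : U -> W -> X) (t : tens) : X :=
  \sum_(p <- repr t) b p.1 p.2.

Lemma tens_piP s t : (\pi_tens s = \pi_tens t) <->
  (forall (X : lmodType K) (b : U -> W -> X), bilinear_map b ->
     \sum_(p <- s) b p.1 p.2 = \sum_(p <- t) b p.1 p.2).
Proof. by split=> [/eqquotP/asboolP//|h]; apply/eqquotP/asboolP. Qed.

Lemma tlift_pi (X : lmodType K) (b : U -> W -> X) s : bilinear_map b ->
  tlift b (\pi_tens s) = \sum_(p <- s) b p.1 p.2.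
Proof. by move=> hb; apply: (tens_piP _ _).1 hb; rewrite reprK. Qed.

Definition tadd (x y : tens) : tens := \pi_tens (repr x ++ repr y).
Definition tscale (c : K) (x : tens) : tens :=
  \pi_tens [seq (c *: p.1, p.2) | p <- repr x].
Definition tzero : tens := \pi_tens [::].

Section Bilinear.
Variables (X : lmodType K) (b : U -> W -> X) (hb : bilinear_map b).

Lemma bilinear_mapZl c u w : b (c *: u) w = c *: b u w.
Proof.
have h0 : b 0 w = 0.
  by have := hb.1 w (-1) 0 0; rewrite /= scaler0 addr0 scaleN1r addNr.
by have := hb.1 w c u 0; rewrite /= h0 !addr0.
Qed.

Lemma bilinear_sumZl c s :
  \sum_(p <- [seq (c *: p.1, p.2) | p <- s]) b p.1 p.2 =
  c *: \sum_(p <- s) b p.1 p.2.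
Proof.
rewrite big_map scaler_sumr; apply: eq_bigr => p _.
exact: bilinear_mapZl.
Qed.
End Bilinear.

Lemma tlift_tadd (X : lmodType K) (b : U -> W -> X) x y : bilinear_map b ->
  tlift b (tadd x y) = tlift b x + tlift b y.
Proof. by move=> hb; rewrite tlift_pi // big_cat. Qed.

Lemma tlift_tscale (X : lmodType K) (b : U -> W -> X) c x : bilinear_map b ->
  tlift b (tscale c x) = c *: tlift b x.
Proof. by move=> hb; rewrite tlift_pi // bilinear_sumZl. Qed.

Lemma tlift_tzero (X : lmodType K) (b : U -> W -> X) : bilinear_map b ->
  tlift b tzero = 0.
Proof. by move=> hb; rewrite tlift_pi // big_nil. Qed.

Lemma tens_eqP (x y : tens) :
  (forall (X : lmodType K) (b : U -> W -> X), bilinear_map b ->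
     tlift b x = tlift b y) -> x = y.
Proof. by move=> h; rewrite -[x]reprK -[y]reprK; apply/tens_piP. Qed.

Lemma taddA : associative tadd.
Proof.
by move=> x y z; apply: tens_eqP => X b hb; rewrite !tlift_tadd // addrA.
Qed.
Lemma taddC : commutative tadd.
Proof.
by move=> x y; apply: tens_eqP => X b hb; rewrite !tlift_tadd // addrC.
Qed.
Lemma tadd0 : left_id tzero tadd.
Proof.
move=> x; apply: tens_eqP => X b hb.
by rewrite tlift_tadd // tlift_tzero // add0r.
Qed.
Lemma taddN : left_inverse tzero (tscale (-1)) tadd.
Proof.
move=> x; apply: tens_eqP => X b hb.
by rewrite tlift_tadd // tlift_tscale // tlift_tzero // scaleN1r addNr.
Qed.

HB.instance Definition _ := GRing.isZmodule.Build tens taddA taddC tadd0 taddN.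

Lemma tscaleA (c d : K) (x : tens) : tscale c (tscale d x) = tscale (c * d) x.
Proof.
by apply: tens_eqP => X b hb; rewrite !tlift_tscale // scalerA.
Qed.
Lemma tscale1 : left_id 1 tscale.
Proof.
by move=> x; apply: tens_eqP => X b hb; rewrite tlift_tscale // scale1r.
Qed.
Lemma tscaleDr : right_distributive tscale +%R.
Proof.
move=> c x y; apply: tens_eqP => X b hb.
by rewrite [_ + _]/(tadd _ _) [X in _ = tlift b X]/(tadd _ _)
  !(tlift_tscale, tlift_tadd) // scalerDr.
Qed.
Lemma tscaleDl x : {morph tscale^~ x : c d / c + d}.
Proof.
move=> c d; apply: tens_eqP => X b hb.
by rewrite [X in _ = tlift b X]/(tadd _ _) !(tlift_tscale, tlift_tadd) //
  scalerDl.
Qed.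

HB.instance Definition _ := GRing.Zmodule_isLmodule.Build K tens
  tscaleA tscale1 tscaleDr tscaleDl.

Lemma tlift_linear (X : lmodType K) (b : U -> W -> X) : bilinear_map b ->
  linear (tlift b).
Proof.
move=> hb c x y.
change (tlift b (tadd (tscale c x) y) = c *: tlift b x + tlift b y).
by rewrite tlift_tadd // tlift_tscale.
Qed.

Lemma tpure_bilinear : bilinear_map tpure.
Proof.
split=> [w c u v|u c w w']; apply: tens_eqP => X b hb;
  rewrite /= (tlift_linear hb) !tlift_pi // !big_seq1 /=.
  exact: hb.1.
exact: hb.2.
Qed.

Lemma tliftE (X : lmodType K) (b : U -> W -> X) u w : bilinear_map b ->
  tlift b (tpure u w) = b u w.
Proof. by move=> hb; rewrite tlift_pi // big_seq1. Qed.

Lemma tens_sum_pure (t : tens) : t = \sum_(p <- repr t) tpure p.1 p.2.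
Proof.
rewrite -[LHS]reprK; elim: (repr t) => [|[u w] s IHs]; first by rewrite big_nil.
rewrite big_cons -IHs; apply: tens_eqP => X b hb.
rewrite -[tpure u w]scale1r (tlift_linear hb) scale1r !tlift_pi //.
by rewrite big_seq1 big_cons.
Qed.

Lemma tlift_unique (X : lmodType K) (f g : {linear tens -> X}) :
  (forall u w, f (tpure u w) = g (tpure u w)) -> f =1 g.
Proof.
move=> fg t; rewrite [t]tens_sum_pure !linear_sum.
by apply: eq_bigr => p _; rewrite fg.
Qed.

End TensorProduct.

Arguments tpure {K U W} u w.

(** * Canonical maps between tensor products *)

Section CanonicalMaps.
Variable K : fieldType.
Implicit Types A B C : lmodType K.

Definition tmap A A' B B' (f : A -> A') (g : B -> B') :
  tens A B -> tens A' B' := tlift (fun a b => tpure (f a) (g b)).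

Definition tassoc A B C : tens (tens A B) C -> tens A (tens B C) :=
  tlift (fun t c => tlift (fun a b => tpure a (tpure b c)) t).

Definition tassocV A B C : tens A (tens B C) -> tens (tens A B) C :=
  tlift (fun a => tlift (fun b c => tpure (tpure a b) c)).

(* P (a (x) b) = b (x) a *)
Definition tflip A B : tens A B -> tens B A := tlift (fun a b => tpure b a).

(* a (x) (b (x) c) |-> b (x) (a (x) c) *)
Definition tflip12 A B C : tens A (tens B C) -> tens B (tens A C) :=
  tlift (fun a => tlift (fun b c => tpure b (tpure a c))).

(* Leg notation on A (x) (B (x) C), whose factors are numbered 1, 2, 3. *)

Definition leg12 A B C (X : tens A B -> tens A B) :
  tens A (tens B C) -> tens A (tens B C) :=
  @tassoc A B C \o tmap X id \o @tassocV A B C.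

Definition leg23 A B C (X : tens B C -> tens B C) :
  tens A (tens B C) -> tens A (tens B C) := tmap id X.

Definition leg13 A B C (X : tens A C -> tens A C) :
  tens A (tens B C) -> tens A (tens B C) :=
  @tflip12 B A C \o leg23 X \o @tflip12 A B C.

Definition leg21 A B C (X : tens B A -> tens B A) :
  tens A (tens B C) -> tens A (tens B C) :=
  leg12 (@tflip B A \o X \o @tflip A B).

End CanonicalMaps.

(** * Partial transposes and partial trace, in a basis [e] of [V] *)

Section PartialTransposeTrace.
Variables (K : fieldType) (V : vectType K) (n : nat) (e : n.-tuple V).
Implicit Types A : lmodType K.

(* the matrix unit E_ij : e_k |-> delta_jk e_i *)
Definition munit (i j : 'I_n) (v : V) : V := coord e j v *: e`_i.

(* E_ij o E_kl o E_ij = delta_jk delta_li E_ij, so that the (i, j) term turns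
   X = sum_kl E_kl (x) X_kl into E_ij (x) X_ji. *)
Definition trl A (X : tens V A -> tens V A) (t : tens V A) : tens V A :=
  \sum_i \sum_j tmap (munit i j) id (X (tmap (munit i j) id t)).

Definition trr A (X : tens A V -> tens A V) (t : tens A V) : tens A V :=
  \sum_i \sum_j tmap id (munit i j) (X (tmap id (munit i j) t)).

Definition tr_full (X : tens V V -> tens V V) : tens V V -> tens V V :=
  trr (trl X).

Definition ptrace A (X : tens V A -> tens V A) (a : A) : A :=
  \sum_i tlift (fun v a' => coord e i v *: a') (X (tpure e`_i a)).

End PartialTransposeTrace.

(* Two-sided inverse of a bijective map; junk if [f] is not bijective. *)
Definition invop (K : fieldType) (A : lmodType K) (f : A -> A) (a : A) : A :=
  xget 0 [set b | f b = a].

Definition tildeop (K : fieldType) (V : vectType K) (n : nat) (e : n.-tuple V)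
  (X : tens V V -> tens V V) : tens V V -> tens V V :=
  trl e (invop (trl e X)).

(** * Analytic functions, analytic subsets, generic points

   [K] is meant to be the field of complex numbers. *)

Section Analytic.
Variable K : numFieldType.

Section SeveralVariables.
Variable n : nat.
Implicit Types (f : 'rV[K]_n -> K) (p z : 'rV[K]_n) (A Omega : set 'rV[K]_n).

Definition monomial (h : 'rV[K]_n) (al : {ffun 'I_n -> nat}) : K :=
  \prod_(k < n) h ord0 k ^+ al k.

(* sum over the multi-indices all of whose entries are < N *)
Definition box_sum (F : {ffun 'I_n -> nat} -> K) (N : nat) : K :=
  \sum_(be : {ffun 'I_n -> 'I_N}) F [ffun k => be k : nat].

Definition analytic_at f p := exists a : {ffun 'I_n -> nat} -> K,
  \forall z \near p,
    cvgn (box_sum (fun al => `|a al * monomial (z - p) al|)) /\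
    box_sum (fun al => a al * monomial (z - p) al) @ \oo --> f z.

Definition analytic_subset Omega A := A `<=` Omega /\
  forall p, Omega p -> exists (m : nat) (f : 'I_m -> 'rV[K]_n -> K),
    \forall z \near p, (forall i, analytic_at (f i) z) /\
                       (A z <-> forall i, f i z = 0).

Definition generic Omega (P : 'rV[K]_n -> Prop) :=
  exists A, [/\ analytic_subset Omega A, A `<` Omega
              & forall z, Omega z -> ~ A z -> P z].

End SeveralVariables.

Definition generic1 (P : K -> Prop) :=
  @generic 1 setT (fun z => P (z ord0 ord0)).

(* The ambient domain is {(x, y) | y <> 0}: the poles of f(x / y), for f
   meromorphic on the plane, form an analytic subset only away from y = 0. *)
Definition generic2 (P : K -> K -> Prop) :=
  @generic 2 [set z | z ord0 ord_max != 0]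
    (fun z => P (z ord0 ord0) (z ord0 ord_max)).

Definition analytic1_at (g : K -> K) (z0 : K) :=
  @analytic_at 1 (fun z => g (z ord0 ord0)) (const_mx z0).

Definition meromorphic (f : K -> K) := forall z0 : K,
  exists (k : nat) (g : K -> K), analytic1_at g z0 /\
    \forall z \near z0^', (z - z0) ^+ k * f z = g z.

(** * Operator-valued meromorphic functions

   An element of Mer (x) End(A) is represented by a total function
   [F : K -> A -> A], two such functions being identified when they agree
   generically; the values of [F] at the exceptional points are irrelevant. *)

Variable A : lmodType K.
Implicit Types F G : K -> A -> A.

Definition expansion m (f : 'I_m -> K -> K) (X : 'I_m -> {linear A -> A}) :
  K -> A -> A := fun z a => \sum_i f i z *: X i a.

Definition Mer F := exists m (f : 'I_m -> K -> K) (X : 'I_m -> {linear A -> A}),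
  (forall i, meromorphic (f i)) /\ generic1 (fun z => F z =1 expansion f X z).

Definition Mer_unit F := Mer F /\ generic1 (fun z => bijective (F z)).

Definition holomorphic_at F z0 :=
  exists m (f : 'I_m -> K -> K) (X : 'I_m -> {linear A -> A}),
    (forall i, analytic1_at (f i) z0) /\
    \forall z \near z0, F z =1 expansion f X z.

Definition holomorphic_ext F z0 G :=
  holomorphic_at G z0 /\ \forall z \near z0^', F z =1 G z.

Definition dom F : set K := [set z0 | exists G, holomorphic_ext F z0 G].

(* the value at z0, for z0 in dom F, of the meromorphic function represented
   by F *)
Definition mval F z0 : A -> A := xget F [set G | holomorphic_ext F z0 G] z0.

End Analytic.

(** * The transfer operator *)

Definition transfer (K : fieldType) (V : vectType K) (n : nat) (e : n.-tuple V)
  (Wp Wm : lmodType K) (Up : K -> tens V Wp -> tens V Wp)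
  (Um : K -> tens V Wm -> tens V Wm) (x : K) : tens Wp Wm -> tens Wp Wm :=
  ptrace e (leg12 (Up x) \o leg13 (Um x)).

(* Main.v *)
(* At a generic pair (x, y), write X, Y for U+_01(x), U+_0'1(y) and A, B for
   U-_02(x), U-_0'2(y).  Cyclicity in 0 and the identity R~(xy)^t0 R(xy)^t0 = 1
   give
     T(x) T(y) = Tr_00' X^t0 Y A^t0 B
               = Tr_00' (X^t0 R~(xy)^t Y^t0')^t (A R(xy) B),
   and likewise for T(y) T(x).  The two reflection equations conjugate the two
   factors on the right by R_0'0(x/y) and R_00'(x/y) in opposite ways, which
   exchanges the two traces.  In a basis of V all this is a computation with
   components acting on W+ and W-.

   A proper analytic subset of a connected domain is closed and has empty
   interior, by the identity theorem, so the good pairs (x, y) are dense.  At a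
   point of dom(T) x dom(T), the commutator is a finite sum of fixed operators
   with continuous coefficients; it vanishes at nearby good pairs, hence at the
   point itself. *)
Require Import Defs.
From HB Require Import structures.
From mathcomp Require Import all_boot all_order all_algebra.
From mathcomp Require Import complex.
From mathcomp Require Import all_classical all_reals topology normedtype.
From mathcomp Require Import sequences ring.
Import Order.TTheory GRing.Theory Num.Theory.
Import numFieldTopology.Exports numFieldNormedType.Exports.
Local Open Scope classical_set_scope.
Local Open Scope ring_scope.

Set Implicit Arguments.
Unset Strict Implicit.
Unset Printing Implicit Defensive.

(** * Linear maps between tensor products *)

Section LinearMaps.
Variables (K : fieldType).
Implicit Types (A B C D : lmodType K).

(** Operators occur as values of functions that are linear only at generic arguments, so linearity
    is carried as a hypothesis and packed into a structure locally. *)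
Lemma lin_sum A B (f : A -> B) (I : Type) (r : seq I) (P : pred I) (F :
  I -> A) :
  linear f -> f (\sum_(i <- r | P i) F i) = \sum_(i <- r | P i) f (F i).
Proof.
move=> lf; pose g : {linear A -> B} := HB.pack f (GRing.isLinear.Build _ _ _ _
  f lf).
exact: (linear_sum g).
Qed.

Lemma lin0 A B (f : A -> B) : linear f -> f 0 = 0.
Proof. by move=> lf; have := lf (-1) 0 0;
  rewrite scaler0 addr0 scaleN1r addNr. Qed.

Lemma linZ A B (f : A -> B) c a : linear f -> f (c *: a) = c *: f a.
Proof. by move=> lf; have := lf c a 0; rewrite (lin0 lf) !addr0. Qed.

Lemma lin_id A : linear (@id A).
Proof. by []. Qed.

Lemma lin_comp A B C (f : B -> C) (g : A -> B) :
  linear f -> linear g -> linear (f \o g).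
Proof. by move=> lf lg c x y; rewrite /= lg lf. Qed.

Lemma lin_sumf A B (I : Type) (r : seq I) (P : pred I) (F : I -> A -> B) :
  (forall i, linear (F i)) -> linear (fun a => \sum_(i <- r | P i) F i a).
Proof.
move=> lF c x y; rewrite scaler_sumr -big_split.
by apply: eq_bigr => i _; exact: lF.
Qed.

Lemma lin_scalef A B (c : K) (f : A -> B) : linear f -> linear (fun a => c *:
  f a).
Proof. by move=> lf d x y; rewrite lf scalerDr !scalerA mulrC. Qed.

Lemma bil_of A B C (b : A -> B -> C) : (forall a, linear (b a)) ->
  (forall y, linear (b^~ y)) -> bilinear_map b.
Proof. by move=> h1 h2; split=> [y c u v|u c w w'] /=;
  [exact: h2 | exact: h1]. Qed.

Lemma tpure_linl A B (b : B) : linear (fun a : A => tpure a b).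
Proof. by move=> c x y; have := (tpure_bilinear A B).1 b c x y. Qed.

Lemma tpure_linr A B (a : A) : linear (fun b : B => tpure a b).
Proof. by move=> c x y; have := (tpure_bilinear A B).2 a c x y. Qed.

(** The uniqueness half of the universal property for unpacked maps; it reduces the identities below
    to pure tensors. *)
Lemma tens_ext A B C (f g : tens A B -> C) : linear f -> linear g ->
  (forall a b, f (tpure a b) = g (tpure a b)) -> f =1 g.
Proof.
move=> lf lg h.
pose f' : {linear tens A B -> C} := HB.pack f (GRing.isLinear.Build _ _ _ _ f
  lf).
pose g' : {linear tens A B -> C} := HB.pack g (GRing.isLinear.Build _ _ _ _ g
  lg).
exact: (@tlift_unique _ _ _ _ f' g').
Qed.

Lemma tmap_bil A B C D (f : A -> C) (g : B -> D) : linear f -> linear g ->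
  bilinear_map (fun a b => tpure (f a) (g b)).
Proof.
move=> lf lg; apply: bil_of => [a|b].
  exact: (lin_comp (tpure_linr _) lg).
exact: (lin_comp (tpure_linl _) lf).
Qed.

Lemma tmap_lin A B C D (f : A -> C) (g : B -> D) : linear f -> linear g ->
  linear (tmap f g).
Proof. by move=> lf lg; apply: tlift_linear; exact: tmap_bil. Qed.

Lemma tmapE A B C D (f : A -> C) (g : B -> D) a b : linear f -> linear g ->
  tmap f g (tpure a b) = tpure (f a) (g b).
Proof. by move=> lf lg; apply: tliftE; exact: tmap_bil. Qed.

(** [tlift (b d) t] is a finite sum over a representative of t that does not depend on d, so
    linearity in d is checked term by term. *)
Lemma tlift_linb A B C D (b : D -> A -> B -> C) :
  (forall d, bilinear_map (b d)) -> (forall x y, linear (fun d => b d x y)) ->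
  forall t, linear (fun d => tlift (b d) t).
Proof. by move=> hb lb t; rewrite /tlift; apply: lin_sumf => p. Qed.

Lemma tassoc_bil1 A B C (c : C) :
  bilinear_map (fun (a : A) (b : B) => tpure a (tpure b c)).
Proof.
apply: bil_of => [a|b]; last exact: tpure_linl.
exact: (lin_comp (tpure_linr _) (tpure_linl _)).
Qed.

Lemma tassoc_bil A B C : bilinear_map (fun (t : tens A B) (c : C) =>
   tlift (fun a b => tpure a (tpure b c)) t).
Proof.
apply: bil_of => [t|c]; last exact/tlift_linear/tassoc_bil1.
apply: tlift_linb => [d|a b]; first exact: tassoc_bil1.
exact: (lin_comp (tpure_linr _) (tpure_linr _)).
Qed.

Lemma tassoc_lin A B C : linear (@tassoc K A B C).
Proof. exact/tlift_linear/tassoc_bil. Qed.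

Lemma tassocE A B C (a : A) (b : B) (c : C) :
  tassoc (tpure (tpure a b) c) = tpure a (tpure b c).
Proof. by rewrite /tassoc tliftE ?tliftE //;
  [exact: tassoc_bil1|exact: tassoc_bil]. Qed.

Lemma tassocV_bil1 A B C (a : A) :
  bilinear_map (fun (b : B) (c : C) => tpure (tpure a b) c).
Proof.
apply: bil_of => [b|c]; first exact: tpure_linr.
exact: (lin_comp (tpure_linl _) (tpure_linr _)).
Qed.

Lemma tassocV_bil A B C : bilinear_map (fun (a : A) =>
   tlift (fun (b : B) (c : C) => tpure (tpure a b) c)).
Proof.
apply: bil_of => [a|t]; first exact/tlift_linear/tassocV_bil1.
apply: tlift_linb => [d|b c]; first exact: tassocV_bil1.
exact: (lin_comp (tpure_linl _) (tpure_linl _)).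
Qed.

Lemma tassocV_lin A B C : linear (@tassocV K A B C).
Proof. exact/tlift_linear/tassocV_bil. Qed.

Lemma tassocVE A B C (a : A) (b : B) (c : C) :
  tassocV (tpure a (tpure b c)) = tpure (tpure a b) c.
Proof. by rewrite /tassocV tliftE ?tliftE //;
  [exact: tassocV_bil1|exact: tassocV_bil]. Qed.

Lemma tflip_bil A B : bilinear_map (fun (a : A) (b : B) => tpure b a).
Proof. by apply: bil_of => [a|b]; [exact: tpure_linl|exact: tpure_linr]. Qed.

Lemma tflip_lin A B : linear (@tflip K A B).
Proof. exact/tlift_linear/tflip_bil. Qed.

Lemma tflipE A B (a : A) (b : B) : tflip (tpure a b) = tpure b a.
Proof. by rewrite /tflip tliftE //; exact: tflip_bil. Qed.

Lemma tflip12_bil1 A B C (a : A) :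
  bilinear_map (fun (b : B) (c : C) => tpure b (tpure a c)).
Proof.
apply: bil_of => [b|c]; last exact: tpure_linl.
exact: (lin_comp (tpure_linr _) (tpure_linr _)).
Qed.

Lemma tflip12_bil A B C : bilinear_map (fun (a : A) =>
   tlift (fun (b : B) (c : C) => tpure b (tpure a c))).
Proof.
apply: bil_of => [a|t]; first exact/tlift_linear/tflip12_bil1.
apply: tlift_linb => [d|b c]; first exact: tflip12_bil1.
exact: (lin_comp (tpure_linr _) (tpure_linl _)).
Qed.

Lemma tflip12_lin A B C : linear (@tflip12 K A B C).
Proof. exact/tlift_linear/tflip12_bil. Qed.

Lemma tflip12E A B C (a : A) (b : B) (c : C) :
  tflip12 (tpure a (tpure b c)) = tpure b (tpure a c).
Proof. by rewrite /tflip12 tliftE ?tliftE //;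
  [exact: tflip12_bil1|exact: tflip12_bil]. Qed.

Lemma leg12_lin A B C (X : tens A B -> tens A B) :
  linear X -> linear (@leg12 K A B C X).
Proof.
move=> lX; apply: lin_comp; last exact: tassocV_lin.
by apply: lin_comp; [exact: tassoc_lin|apply: tmap_lin].
Qed.

Lemma leg23_lin A B C (X : tens B C -> tens B C) :
  linear X -> linear (@leg23 K A B C X).
Proof. by move=> lX; exact: tmap_lin. Qed.

Lemma leg13_lin A B C (X : tens A C -> tens A C) :
  linear X -> linear (@leg13 K A B C X).
Proof.
move=> lX; apply: lin_comp; last exact: tflip12_lin.
by apply: lin_comp; [exact: tflip12_lin|exact: leg23_lin].
Qed.

Lemma leg21_lin A B C (X : tens B A -> tens B A) :
  linear X -> linear (@leg21 K A B C X).
Proof.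
move=> lX; apply: leg12_lin; apply: lin_comp; last exact: tflip_lin.
by apply: lin_comp; [exact: tflip_lin|].
Qed.

(** Surjectivity makes the set of preimages nonempty, so the default 0 of [invop] is never taken. *)
Lemma invopK A (f : A -> A) : bijective f -> cancel (invop f) f.
Proof.
move=> [g fg gf] a; rewrite /invop.
by apply: (@xgetPex _ 0 [set b | f b = a]); exists (g a); exact: gf.
Qed.

Lemma invop_lin A (f : A -> A) : linear f -> bijective f -> linear (invop f).
Proof.
move=> lf bf c x y; apply: (bij_inj bf).
by rewrite lf !invopK.
Qed.

Lemma invopKV A (f : A -> A) : bijective f -> cancel f (invop f).
Proof. by move=> bf a; apply: (bij_inj bf); rewrite invopK. Qed.

End LinearMaps.

(** * Components with respect to a basis of [V] *)

Section Components.
Variables (K : fieldType) (V : vectType K) (n : nat) (e : n.-tuple V).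
Hypothesis he : basis_of fullv e.
Implicit Types (A B C W : lmodType K).

Lemma coord_basisE (i j : 'I_n) : coord e i e`_j = (i == j)%:R.
Proof. by rewrite coord_free ?(basis_free he) // eq_sym. Qed.

Lemma coord_expand v : v = \sum_(i < n) coord e i v *: e`_i.
Proof. exact: (coord_basis he (memvf v)). Qed.

(** Contraction of the first leg with the i-th vector of the dual basis. *)
Definition slice A (i : 'I_n) : tens V A -> A :=
  tlift (fun v a => coord e i v *: a).

(** The (i, j) entry of X, seen as an n by n matrix of endomorphisms of A. *)
Definition block A (X : tens V A -> tens V A) (i j : 'I_n) (a : A) : A :=
  slice i (X (tpure e`_j a)).

Lemma slice_bil A (i : 'I_n) :
  bilinear_map (fun (v : V) (a : A) => coord e i v *: a).
Proof.
apply: bil_of => [v c x y|a c x y].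
  by rewrite scalerDr !scalerA mulrC.
by rewrite linearP scalerDl scalerA.
Qed.

Lemma slice_lin A i : linear (@slice A i).
Proof. exact/tlift_linear/slice_bil. Qed.

Lemma sliceE A i v (a : A) : slice i (tpure v a) = coord e i v *: a.
Proof. by rewrite /slice tliftE //; exact: slice_bil. Qed.

Lemma slice_basis A (i j : 'I_n) (a : A) :
  slice i (tpure e`_j a) = (i == j)%:R *: a.
Proof. by rewrite sliceE coord_basisE. Qed.

(** A basis of V makes V (x) A a direct sum of n copies of A, whatever the dimension of A; on pure
    tensors this is the expansion of v. *)
Lemma tens_slices A (t : tens V A) : t = \sum_(i < n) tpure e`_i (slice i t).
Proof.
apply: (@tens_ext K V A _ id (fun t => \sum_(i < n) tpure e`_i (slice i t))) =>
  //.
  by apply: lin_sumf => i; apply: (lin_comp (tpure_linr _) (@slice_lin A i)).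
move=> v a /=; rewrite {1}(coord_expand v).
rewrite (lin_sum _ _ _ (tpure_linl a)); apply: eq_bigr => i _.
by rewrite sliceE (linZ _ _ (tpure_linl a)) (linZ _ _ (tpure_linr _)).
Qed.

Lemma slice_op A (X : tens V A -> tens V A) i t : linear X ->
  slice i (X t) = \sum_j block X i j (slice j t).
Proof.
move=> lX; rewrite {1}(tens_slices t) (lin_sum _ _ _ lX).
by rewrite (lin_sum _ _ _ (@slice_lin A i)).
Qed.

Lemma block_lin A (X : tens V A -> tens V A) i j :
  linear X -> linear (block X i j).
Proof.
move=> lX; apply: (lin_comp (@slice_lin A i)).
exact: (lin_comp lX (tpure_linr _)).
Qed.

Lemma block_comp A (X Y : tens V A -> tens V A) i j a : linear X ->
  block (X \o Y) i j a = \sum_k block X i k (block Y k j a).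
Proof. by move=> lX; rewrite /block /= slice_op. Qed.

Lemma block_id A i j (a : A) : block id i j a = (i == j)%:R *: a.
Proof. exact: slice_basis. Qed.

Lemma munit_lin i j : linear (munit e i j).
Proof. by move=> c x y; rewrite /munit linearP scalerDl scalerA. Qed.

Lemma munit_basis (i j k : 'I_n) : munit e i j e`_k = (j == k)%:R *: e`_i.
Proof. by rewrite /munit coord_basisE. Qed.

Lemma sum_delta A (F : 'I_n -> A) i : \sum_j (i == j)%:R *: F j = F i.
Proof.
rewrite (bigD1 i) //= eqxx scale1r big1 ?addr0 // => j /negbTE ji.
by rewrite eq_sym ji scale0r.
Qed.

Lemma sum_delta' A (F : 'I_n -> A) i : \sum_j (j == i)%:R *: F j = F i.
Proof. by rewrite -[RHS]sum_delta; apply: eq_bigr => j _; rewrite eq_sym. Qed.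

Lemma trl_lin A (X : tens V A -> tens V A) : linear X -> linear (trl e X).
Proof.
move=> lX; apply: lin_sumf => i; apply: lin_sumf => j.
have lm := tmap_lin (munit_lin i j) (@lin_id K A).
exact: (lin_comp lm (lin_comp lX lm)).
Qed.

Lemma slice_munit A (i k l : 'I_n) (t : tens V A) :
  slice i (tmap (munit e k l) id t) = (i == k)%:R *: slice l t.
Proof.
have lm := tmap_lin (munit_lin k l) (@lin_id K A).
apply: (@tens_ext K V A A (fun t => slice i (tmap (munit e k l) id t))
  (fun t => (i == k)%:R *: slice l t)).
- exact: (lin_comp (@slice_lin A i) lm).
- exact: (lin_scalef _ (@slice_lin A l)).
move=> v a; rewrite tmapE //; last exact: munit_lin.
by rewrite !sliceE /munit linearZ /= coord_basisE scalerA mulrC.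
Qed.

(** In the (k, l) term of [trl], the inner matrix unit forces l = j and the outer one k = i, which
    leaves a single block of X with its indices exchanged. *)
Lemma block_trl A (X : tens V A -> tens V A) i j a : linear X ->
  block (trl e X) i j a = block X j i a.
Proof.
move=> lX; rewrite /block /trl (lin_sum _ _ _ (@slice_lin A i)).
rewrite -[RHS](sum_delta (fun k => slice j (X (tpure e`_k a)))).
apply: eq_bigr => k _.
rewrite (lin_sum _ _ _ (@slice_lin A i)).
under eq_bigr => l _.
  rewrite slice_munit tmapE ?munit_basis; [|exact: munit_lin|exact: lin_id].
  rewrite (linZ _ _ (tpure_linl a)) (linZ _ _ lX) (linZ _ _ (@slice_lin A l)).
  rewrite scalerA mulrC -scalerA.
  over.
by rewrite sum_delta'.
Qed.

(** The matrix coefficient of X from e_j (x) e_l to e_i (x) e_k: the row pair (i, k) precedes the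
    column pair (j, l). *)
Definition entry (X : tens V V -> tens V V) (i k j l : 'I_n) : K :=
  coord e k (block X i j e`_l).

Lemma entry_trl X i k j l : linear X -> entry (trl e X) i k j l = entry X j k i
  l.
Proof. by move=> lX; rewrite /entry block_trl. Qed.

Lemma slice_tmapr A B (f : A -> B) i t : linear f ->
  slice i (tmap id f t) = f (slice i t).
Proof.
move=> lf; have lm := tmap_lin (@lin_id K V) lf.
apply: (@tens_ext K V A B (fun t => slice i (tmap id f t)) (fun t =>
  f (slice i t))).
- exact: (lin_comp (@slice_lin B i) lm).
- exact: (lin_comp lf (@slice_lin A i)).
by move=> v a; rewrite tmapE // !sliceE linZ.
Qed.

Lemma entry_comp X Y i k j l : linear X ->
  entry (X \o Y) i k j l =
  \sum_p \sum_q entry X i k p q * entry Y p q j l.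
Proof.
move=> lX; rewrite /entry block_comp // linear_sum /=; apply: eq_bigr => p _.
rewrite {1}(coord_expand (block Y p j _)) (lin_sum _ _ _ (block_lin _ _ lX))
  linear_sum.
by apply: eq_bigr => q _; rewrite (linZ _ _ (block_lin _ _ lX)) linearZ /=
  mulrC.
Qed.

Lemma entry_id i k j l : entry id i k j l = (i == j)%:R * (k == l)%:R.
Proof. by rewrite /entry block_id linearZ /= coord_basisE. Qed.

Lemma trr_lin X : linear X -> linear (trr e X : tens V V -> tens V V).
Proof.
move=> lX; apply: lin_sumf => i; apply: lin_sumf => j.
have lm := tmap_lin (@lin_id K V) (munit_lin i j).
exact: (lin_comp lm (lin_comp lX lm)).
Qed.

Lemma entry_trr X i k j l : linear X -> entry (trr e X) i k j l = entry X i l j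
  k.
Proof.
move=> lX; rewrite /entry /block /trr !(lin_sum _ _ _ (@slice_lin V i))
  linear_sum.
(* Scalars are viewed in [K^o] so that [sum_delta] and [sum_delta'] apply to them; the double sum
   then collapses as in [block_trl]. *)
rewrite -[RHS](sum_delta (fun p => coord e l (slice i (X (tpure e`_j e`_p))) :
  K^o)).
apply: eq_bigr => p _.
rewrite (lin_sum _ _ _ (@slice_lin V i)) linear_sum.
rewrite -[X in _ *: X](sum_delta' (fun q =>
  coord e q (slice i (X (tpure e`_j e`_p))) : K^o)).
rewrite scaler_sumr; apply: eq_bigr => q _.
rewrite slice_tmapr; last exact: munit_lin.
rewrite tmapE ?munit_basis; [|exact: lin_id|exact: munit_lin].
rewrite (linZ _ _ (tpure_linr _)) (linZ _ _ lX) (linZ _ _ (@slice_lin V i)).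
rewrite (linZ _ _ (@munit_lin _ _)) /munit !linearZ /= coord_basisE.
by congr (_ * _); rewrite mulrC.
Qed.

Lemma entry_tr_full X i k j l :
  linear X -> entry (tr_full e X) i k j l = entry X j l i k.
Proof. by move=> lX; rewrite entry_trr ?entry_trl //; exact: trl_lin. Qed.

Lemma tr_full_lin X : linear X -> linear (tr_full e X).
Proof. by move=> lX; apply: trr_lin; exact: trl_lin. Qed.

Lemma entry_flip X i k j l : linear X ->
  entry (@tflip K V V \o X \o @tflip K V V) i k j l = entry X k i l j.
Proof.
move=> lX.
have slf p q (t : tens V V) : coord e p (slice q (tflip t)) = coord e q (slice
  p t) :> K^o.
  apply: (@tens_ext K V V K^o (fun t => coord e p (slice q (tflip t)))
    (fun t => coord e q (slice p t))).
  - by move=> c x y; rewrite tflip_lin slice_lin linearP.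
  - by move=> c x y; rewrite slice_lin linearP.
  by move=> a b; rewrite tflipE !sliceE !linearZ /= mulrC.
by rewrite /entry /block /= slf tflipE.
Qed.

Lemma slice_leg12 B C (X : tens V B -> tens V B) (i j : 'I_n) (t : tens B C) :
  linear X ->
  slice i (leg12 X (tpure e`_j t)) = tmap (block X i j) id t.
Proof.
move=> lX; have lc := block_lin i j lX.
apply: (@tens_ext K B C _ (fun t => slice i (leg12 X (tpure e`_j t)))
   (tmap (block X i j) id)).
- exact: (lin_comp (@slice_lin _ i) (lin_comp (leg12_lin lX) (tpure_linr _))).
- exact: tmap_lin.
move=> b c; rewrite tmapE // /leg12 /= tassocVE tmapE //.
rewrite (tens_slices (X _)) (lin_sum _ _ _ (tpure_linl c)).
rewrite (lin_sum _ _ _ (@tassoc_lin _ _ _ _)) (lin_sum _ _ _ (@slice_lin _ i)).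
under eq_bigr => k _ do rewrite tassocE slice_basis.
by rewrite sum_delta.
Qed.

Lemma slice_leg13 B C (X : tens V C -> tens V C) (i j : 'I_n) (t : tens B C) :
  linear X ->
  slice i (leg13 X (tpure e`_j t)) = tmap id (block X i j) t.
Proof.
move=> lX; have lc := block_lin i j lX.
apply: (@tens_ext K B C _ (fun t => slice i (leg13 X (tpure e`_j t)))
   (tmap id (block X i j))).
- exact: (lin_comp (@slice_lin _ i) (lin_comp (leg13_lin lX) (tpure_linr _))).
- exact: tmap_lin.
move=> b c; rewrite tmapE // /leg13 /leg23 /= tflip12E tmapE //.
rewrite (tens_slices (X _)) (lin_sum _ _ _ (tpure_linr b)).
rewrite (lin_sum _ _ _ (@tflip12_lin _ _ _ _)) (lin_sum _ _ _ (@slice_lin _ i)).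
under eq_bigr => k _ do rewrite tflip12E slice_basis.
by rewrite sum_delta.
Qed.

(** * Components along two copies of V *)

Section ThreeLegs.
Variable W : lmodType K.
Implicit Types (t : tens V (tens V W)).

Definition slice2 (i k : 'I_n) t : W := slice k (slice i t).

Lemma slice2_lin i k : linear (slice2 i k).
Proof. exact: (lin_comp (@slice_lin _ k) (@slice_lin _ i)). Qed.

Lemma slice2_leg12 X i k t : linear X ->
  slice2 i k (leg12 X t) = \sum_j \sum_l entry X i k j l *: slice2 j l t.
Proof.
move=> lX; rewrite /slice2 slice_op; last exact: leg12_lin.
rewrite (lin_sum _ _ _ (@slice_lin W k)); apply: eq_bigr => j _.
rewrite {1}/block slice_leg12 //.
have lc := block_lin i j lX; have lm := tmap_lin lc (@lin_id K W).
rewrite {1}(tens_slices (slice j t)) (lin_sum _ _ _ lm) (lin_sum _ _ _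
  (@slice_lin W k)).
by apply: eq_bigr => l _; rewrite tmapE // sliceE.
Qed.

Lemma slice2_leg21 X i k t : linear X ->
  slice2 i k (leg21 X t) = \sum_j \sum_l entry X k i l j *: slice2 j l t.
Proof.
move=> lX; rewrite slice2_leg12; last first.
  exact: (lin_comp (lin_comp (@tflip_lin _ _ _) lX) (@tflip_lin _ _ _)).
by apply: eq_bigr => j _; apply: eq_bigr => l _; rewrite entry_flip.
Qed.

Lemma slice2_leg13 (X : tens V W -> tens V W) i k t : linear X ->
  slice2 i k (leg13 X t) = \sum_j block X i j (slice2 j k t).
Proof.
move=> lX; rewrite /slice2 slice_op; last exact: leg13_lin.
rewrite (lin_sum _ _ _ (@slice_lin W k)); apply: eq_bigr => j _.
rewrite {1}/block slice_leg13 // slice_tmapr //; exact: block_lin.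
Qed.

Lemma slice2_leg23 (X : tens V W -> tens V W) i k t : linear X ->
  slice2 i k (leg23 X t) = \sum_l block X k l (slice2 i l t).
Proof. by move=> lX; rewrite /slice2 slice_tmapr // slice_op. Qed.

End ThreeLegs.
End Components.
(** * Commutation of the transfer operators at a generic pair *)

Section Contraction.
Variables (K : fieldType) (A B : lmodType K) (I : finType).

(** The pairing of two families is unchanged when f is transformed by m and g by the transpose of r
    = m^-1: bilinearity pulls both matrices out and they contract to the identity. *)
Lemma contract_pure (m r : I -> I -> K) (f : I -> A) (g : I -> B) :
  (forall p p', \sum_q m q p * r p' q = (p == p')%:R) ->
  \sum_q tpure (\sum_p m q p *: f p) (\sum_p r p q *: g p) =
  \sum_p tpure (f p) (g p).
Proof.
move=> mr.
transitivity (\sum_q \sum_p \sum_p' (m q p * r p' q) *: tpure (f p) (g p')).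
  apply: eq_bigr => q _; rewrite (lin_sum _ _ _ (tpure_linl _)).
  apply: eq_bigr => p _; rewrite (lin_sum _ _ _ (tpure_linr _)).
  apply: eq_bigr => p' _.
  by rewrite (linZ _ _ (tpure_linl _)) (linZ _ _ (tpure_linr _)) scalerA.
rewrite exchange_big; apply: eq_bigr => p _.
rewrite exchange_big (bigD1 p) //= -scaler_suml mr eqxx scale1r big1 ?addr0 //.
by move=> p' p'p; rewrite -scaler_suml mr eq_sym (negbTE p'p) scale0r.
Qed.

(* With [s' = s^-1] and [t' = t^-1], the hypotheses read [s G = G' t] and
   [s^-T F = F' t^-T]; the pairing [Tr (F^T G)] is therefore that of [F', G'].
     *)
Lemma intertwine (F F' : I -> I -> A) (G G' : I -> I -> B)
    (s s' t t' : I -> I -> K) :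
  (forall p q, \sum_k s' p k * s k q = (p == q)%:R) ->
  (forall p q, \sum_k t p k * t' k q = (p == q)%:R) ->
  (forall p q, \sum_k s p k *: G k q = \sum_k t k q *: G' p k) ->
  (forall p q, \sum_k s' k p *: F k q = \sum_k t' q k *: F' p k) ->
  \sum_q \sum_p tpure (F p q) (G p q) = \sum_q \sum_p tpure (F' p q) (G' p q).
Proof.
move=> hs ht hG hF.
transitivity (\sum_q \sum_p tpure (\sum_k s' k p *: F k q) (\sum_k s p k *:
  G k q)).
  apply: eq_bigr => q _.
  by rewrite (@contract_pure (fun q p => s' p q) (fun p q => s q p)).
rewrite [RHS]exchange_big [LHS]exchange_big; apply: eq_bigr => p _.
under eq_bigr => q _ do rewrite hF hG.
rewrite (@contract_pure (fun q k => t' q k) (fun k q => t k q)) // => k k'.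
by under eq_bigr do rewrite mulrC; rewrite ht eq_sym.
Qed.

End Contraction.

Lemma sum_pairs (M : nmodType) (I : finType) (E : I * I -> I * I -> M) :
  \sum_q \sum_p E p q = \sum_b \sum_d \sum_a \sum_c E (a, c) (b, d).
Proof.
rewrite [RHS]pair_big /=; apply: eq_bigr => -[b d] _ /=.
by rewrite [RHS]pair_big /=; apply: eq_bigr => -[a c] _.
Qed.

Lemma sum_triple (M : nmodType) (I : finType) (E : I -> I -> I -> M) :
  \sum_l \sum_i \sum_k E l i k = \sum_k \sum_p E p.2 p.1 k.
Proof.
under eq_bigr => l _ do rewrite exchange_big.
rewrite exchange_big; apply: eq_bigr => k _.
by rewrite exchange_big pair_big.
Qed.

Section Commute.
Variables (K : fieldType) (V : vectType K) (n : nat) (e : n.-tuple V).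
Hypothesis he : basis_of fullv e.

Lemma scaler_swap (W : lmodType K) (a b : K) (w : W) : a *: (b *: w) = b *:
  (a *: w).
Proof. by rewrite !scalerA mulrC. Qed.

Lemma slice2_basis (W : lmodType K) (i k b d : 'I_n) (w : W) :
  slice2 e i k (tpure e`_b (tpure e`_d w)) = (i == b)%:R *: ((k == d)%:R *: w).
Proof.
by rewrite /slice2 slice_basis // (linZ _ _ (@slice_lin _ _ _ _ _ _))
  slice_basis.
Qed.

Lemma tens_slices2 (W : lmodType K) (t : tens V (tens V W)) :
  t = \sum_(j < n) \sum_(l < n) tpure e`_j (tpure e`_l (slice2 e j l t)).
Proof.
rewrite {1}(tens_slices he t); apply: eq_bigr => j _.
by rewrite {1}(tens_slices he (slice e j t)) (lin_sum _ _ _ (tpure_linr _)).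
Qed.

Lemma leg12_basis (W : lmodType K) X (b d : 'I_n) (w : W) : linear X ->
  leg12 X (tpure e`_b (tpure e`_d w)) =
  \sum_j \sum_l entry e X j l b d *: tpure e`_j (tpure e`_l w).
Proof.
move=> lX; rewrite [LHS]tens_slices2.
apply: eq_bigr => j _; apply: eq_bigr => l _.
rewrite slice2_leg12 //.
have -> : \sum_p \sum_q entry e X j l p q *:
  slice2 e p q (tpure e`_b (tpure e`_d w))
   = entry e X j l b d *: w.
  under eq_bigr => p _ do
    under eq_bigr => q _ do rewrite slice2_basis scaler_swap (scaler_swap _ (q
      == d)%:R).
  under eq_bigr => p _ do rewrite -scaler_sumr sum_delta'.
  by rewrite sum_delta'.
by rewrite (linZ _ _ (tpure_linr _)) (linZ _ _ (tpure_linr _)).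
Qed.

(** These are the entries over V (x) V of one side of a reflection equation without its outer
    factor. Q acts on the second copy of V and P on the first, so each contributes one summation
    index, and M joins the two. *)
Lemma slice2_leg13_12_23 (W : lmodType K) (P Q : tens V W -> tens V W) M
    (a c b d : 'I_n) w : linear P -> linear Q -> linear M ->
  slice2 e a c (leg13 P (leg12 M (leg23 Q (tpure e`_b (tpure e`_d w))))) =
  \sum_i \sum_l entry e M i c b l *: block e P a i (block e Q l d w).
Proof.
move=> lP lQ lM; rewrite slice2_leg13 //; apply: eq_bigr => i _.
rewrite slice2_leg12 //.
have lc := block_lin e a i lP.
transitivity (block e P a i (\sum_l entry e M i c b l *: block e Q l d w)).
  congr (block _ _ _ _ _).
  have h j l : slice2 e j l (leg23 Q (tpure e`_b (tpure e`_d w))) =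
      (j == b)%:R *: block e Q l d w.
    rewrite slice2_leg23 //.
    under eq_bigr => m _ do rewrite slice2_basis !(linZ _ _ (block_lin _ _ _
      lQ)).
    by rewrite -scaler_sumr sum_delta'.
  under eq_bigr => j _ do under eq_bigr => l _ do rewrite h scaler_swap.
  under eq_bigr => j _ do rewrite -scaler_sumr.
  by rewrite sum_delta'.
by rewrite (lin_sum _ _ _ lc); apply: eq_bigr => l _; rewrite linZ.
Qed.

Lemma slice2_leg23_21_13 (W : lmodType K) (P Q : tens V W -> tens V W) M
    (a c b d : 'I_n) w : linear P -> linear Q -> linear M ->
  slice2 e a c (leg23 Q (leg21 M (leg13 P (tpure e`_b (tpure e`_d w))))) =
  \sum_l \sum_j entry e M l a d j *: block e Q c l (block e P j b w).
Proof.
move=> lP lQ lM; rewrite slice2_leg23 //; apply: eq_bigr => l _.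
rewrite slice2_leg21 //.
have lc := block_lin e c l lQ.
rewrite (lin_sum _ _ _ lc); apply: eq_bigr => j _.
transitivity (block e Q c l (entry e M l a d j *: block e P j b w)).
  congr (block _ _ _ _ _).
  have h m : slice2 e j m (leg13 P (tpure e`_b (tpure e`_d w))) =
      (m == d)%:R *: block e P j b w.
    rewrite slice2_leg13 //.
    under eq_bigr => p _ do rewrite slice2_basis !(linZ _ _ (block_lin _ _ _
      lP)).
    by rewrite sum_delta'.
  under eq_bigr => m _ do rewrite h scaler_swap.
  by rewrite sum_delta'.
by rewrite linZ.
Qed.

Lemma entry_inverse X Y (p q : 'I_n * 'I_n) : linear X -> X \o Y =1 id ->
  \sum_k entry e X p.1 p.2 k.1 k.2 * entry e Y k.1 k.2 q.1 q.2 = (p == q)%:R.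
Proof.
move=> lX XY; rewrite -(pair_big xpredT xpredT (fun k l =>
  entry e X p.1 p.2 k l * entry e Y k l q.1 q.2)) /= -entry_comp //.
rewrite /entry /block XY -[slice _ _ _]/(block e id p.1 q.1 _) -[LHS]/(entry e
  id _ _ _ _).
by rewrite entry_id // -natrM mulnb.
Qed.

Variables (Wp Wm : lmodType K).
Implicit Types (X Y : tens V Wp -> tens V Wp) (A B : tens V Wm -> tens V Wm).

Let TT X A : tens Wp Wm -> tens Wp Wm := ptrace e (leg12 X \o leg13 A).

Lemma transfer_lin X A : linear X -> linear A -> linear (TT X A).
Proof.
move=> lX lA; apply: lin_sumf => i; apply: block_lin.
by apply: lin_comp; [exact: leg12_lin|exact: leg13_lin].
Qed.

Lemma transferE X A u w : linear X -> linear A ->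
  TT X A (tpure u w) = \sum_i \sum_k tpure (block e X i k u) (block e A k i w).
Proof.
move=> lX lA; apply: eq_bigr => i _.
rewrite -/(slice e i _) -/(block e (leg12 X \o leg13 A) i i _) block_comp //;
  last exact: leg12_lin.
apply: eq_bigr => k _; rewrite {1}/block slice_leg12 // {2}/block slice_leg13
  //.
have lc := block_lin e k i lA; have lc' := block_lin e i k lX.
by rewrite tmapE // tmapE.
Qed.

Lemma transfer_transferE X A Y B u w :
  linear X -> linear A -> linear Y -> linear B ->
  TT X A (TT Y B (tpure u w)) =
  \sum_j \sum_l \sum_i \sum_k
    tpure (block e X i k (block e Y j l u)) (block e A k i (block e B l j w)).
Proof.
move=> lX lA lY lB; have lT := transfer_lin lX lA.
rewrite [TT Y B _]transferE // (lin_sum _ _ _ lT); apply: eq_bigr => j _.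
rewrite (lin_sum _ _ _ lT); apply: eq_bigr => l _; exact: transferE.
Qed.

(** At one pair (x, y), the operators X, Y, A, B stand for U+(x), U+(y), U-(x), U-(y), while S is
    R(x/y) and M is R(xy). Inserting M^t0 and its inverse turns each product of transfers into a
    pairing of entries; [intertwine] identifies the two pairings. *)
Lemma transfer_commute X Y A B (S M : tens V V -> tens V V) :
  linear X -> linear Y -> linear A -> linear B -> linear S -> linear M ->
  bijective S -> bijective (trl e M) ->
  leg21 S \o leg13 A \o leg12 M \o leg23 B
    =1 leg23 B \o leg21 M \o leg13 A \o leg12 S ->
  leg21 (tr_full e (invop S)) \o leg13 (trl e X)
    \o leg12 (tr_full e (tildeop e M)) \o leg23 (trl e Y)
  =1 leg23 (trl e Y) \o leg21 (tr_full e (tildeop e M)) \o leg13 (trl e X)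
    \o leg12 (tr_full e (invop S)) ->
  TT X A \o TT Y B =1 TT Y B \o TT X A.
Proof.
move=> lX lY lA lB lS lM bS bM re dre.
have lTx := transfer_lin lX lA; have lTy := transfer_lin lY lB.
apply: (tens_ext (lin_comp lTx lTy) (lin_comp lTy lTx)) => u w /=.
rewrite !transfer_transferE //.
have lX' := trl_lin e lX; have lY' := trl_lin e lY.
have lM' := trl_lin e lM.
have lI := invop_lin lS bS; have lI' := tr_full_lin e lI.
have lN := invop_lin lM' bM.
have lt : linear (tildeop e M) by exact: trl_lin.
have ltt := tr_full_lin e lt.
(* [G] and [G'] are the entries of [A R B] and [B R_21 A], [F] and [F'] those of
   [X^t0 R~^t Y^t0'] and [Y^t0' R~_21^t X^t0]. *)
pose F (p q : 'I_n * 'I_n) := slice2 e p.1 p.2 (leg13 (trl e X) (leg12 (tr_full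
  e (tildeop e M))
   (leg23 (trl e Y) (tpure e`_q.1 (tpure e`_q.2 u))))).
pose F' (p q : 'I_n * 'I_n) := slice2 e p.1 p.2 (leg23 (trl e Y) (leg21
  (tr_full e (tildeop e M))
   (leg13 (trl e X) (tpure e`_q.1 (tpure e`_q.2 u))))).
pose G (p q : 'I_n * 'I_n) := slice2 e p.1 p.2 (leg13 A (leg12 M
   (leg23 B (tpure e`_q.1 (tpure e`_q.2 w))))).
pose G' (p q : 'I_n * 'I_n) := slice2 e p.1 p.2 (leg23 B (leg21 M
   (leg13 A (tpure e`_q.1 (tpure e`_q.2 w))))).
pose mm (p q : 'I_n * 'I_n) := entry e (trl e M) p.1 p.2 q.1 q.2.
pose ni (p q : 'I_n * 'I_n) := entry e (invop (trl e M)) p.1 p.2 q.1 q.2.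
have nm p p' : \sum_q ni p q * mm q p' = (p == p')%:R.
  exact/entry_inverse/invopKV.
have FG (W : lmodType K) (P : tens V W -> tens V W) Q N (v : W) (a c b d :
  'I_n) :
    linear P -> linear Q -> linear N ->
    slice2 e a c (leg13 P (leg12 N (leg23 Q (tpure e`_b (tpure e`_d v))))) =
    \sum_(p : 'I_n * 'I_n) entry e N p.1 c b p.2 *:
      block e P a p.1 (block e Q p.2 d v).
  move=> lP lQ lN'; rewrite slice2_leg13_12_23 //.
  by rewrite (pair_big xpredT xpredT (fun i l => entry e N i c b l *:
    block e P a i (block e Q l d v))).
have FG' (W : lmodType K) (P : tens V W -> tens V W) Q N (v : W) (a c b d :
  'I_n) :
    linear P -> linear Q -> linear N ->
    slice2 e a c (leg23 Q (leg21 N (leg13 P (tpure e`_b (tpure e`_d v))))) =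
    \sum_(p : 'I_n * 'I_n) entry e N p.1 a d p.2 *:
      block e Q c p.1 (block e P p.2 b v).
  move=> lP lQ lN'; rewrite slice2_leg23_21_13 //.
  by rewrite (pair_big xpredT xpredT (fun l j => entry e N l a d j *:
    block e Q c l (block e P j b v))).
(* Up to a rearrangement of indices, the entries of R~^t and of R are those of the mutually inverse
   matrices [ni] and [mm], which makes [contract_pure] applicable. *)
have tiE (i c b l : 'I_n) : entry e (tr_full e (tildeop e M)) i c b l = ni (i,
  l) (b, c).
  by rewrite entry_tr_full // entry_trl.
have MiE (i c b l : 'I_n) : entry e M i c b l = mm (b, c) (i, l) by rewrite /mm
  entry_trl.
have key : \sum_q \sum_p tpure (F p q) (G p q) = \sum_q \sum_p tpure (F' p q)
  (G' p q).
  pose s (p q : 'I_n * 'I_n) := entry e S p.1 p.2 q.1 q.2.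
  pose si (p q : 'I_n * 'I_n) := entry e (invop S) p.1 p.2 q.1 q.2.
  (* The left factor R_0'0 acts through exchanged legs, hence the swapped pairs; the right factor
     R_00' keeps the plain ones. The full transpose in the dual equation supplies the transposed
     inverses. *)
  apply: (@intertwine _ _ _ _ F F' G G' (fun p q => s (p.2, p.1) (q.2, q.1))
    (fun p q => si (p.2, p.1) (q.2, q.1)) s si).
  - move=> p q; rewrite (reindex_inj (h := fun k :
    'I_n * 'I_n => (k.2, k.1))) /=; last first.
      by move=> [? ?] [? ?] [-> ->].
    rewrite (entry_inverse (p.2, p.1) (q.2, q.1) lI (invopKV bS)).
    by case: p q => [? ?] [? ?]; rewrite !xpair_eqE andbC.
  - by move=> p q; apply: entry_inverse => // t /=; exact: invopK.
  - move=> [a c] [b d].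
    (* The (a, c) component of the reflection equation on a basis vector. On the right, [leg12 S]
       yields a combination of basis vectors, and linearity of the remaining word turns it into
       entries of G'. *)
    have := congr1 (slice2 e a c) (re (tpure e`_b (tpure e`_d w))).
    rewrite /= slice2_leg21 // leg12_basis //.
    have l2 : linear (slice2 e a c \o leg23 B \o leg21 M \o leg13 A).
      apply: lin_comp; last exact: leg13_lin.
      apply: lin_comp; last exact: leg21_lin.
      by apply: lin_comp; [exact: slice2_lin|exact: leg23_lin].
    rewrite -[X in _ = X -> _]/((slice2 e a c \o leg23 B \o leg21 M \o leg13 A)
      _).
    rewrite (lin_sum _ _ _ l2); under [RHS]eq_bigr =>
      j _ do rewrite (lin_sum _ _ _ l2).
    rewrite !pair_big /= => h; rewrite [LHS]h; apply: eq_bigr => k _.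
    exact: (linZ _ _ l2).
  - move=> [a c] [b d].
    have := congr1 (slice2 e a c) (dre (tpure e`_b (tpure e`_d u))).
    rewrite /= slice2_leg21 // leg12_basis //.
    have l2 : linear (slice2 e a c \o leg23 (trl e Y) \o leg21 (tr_full e
      (tildeop e M)) \o leg13 (trl e X)).
      apply: lin_comp; last exact: leg13_lin.
      apply: lin_comp; last exact: leg21_lin.
      by apply: lin_comp; [exact: slice2_lin|exact: leg23_lin].
    rewrite -[X in _ = X -> _]/((slice2 e a c \o leg23 (trl e Y) \o leg21
      (tr_full e (tildeop e M)) \o leg13 (trl e X)) _).
    rewrite (lin_sum _ _ _ l2); under [RHS]eq_bigr =>
      j _ do rewrite (lin_sum _ _ _ l2).
    rewrite !pair_big /= => h.
    transitivity (\sum_k entry e (tr_full e (invop S)) c a k.2 k.1 *: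
      F k (b, d)).
      by apply: eq_bigr => k _; rewrite entry_tr_full.
    rewrite [LHS]h; apply: eq_bigr => k _.
    by rewrite entry_tr_full //; exact: (linZ _ _ l2).
(* In T(x) T(y) the indices j and k become d and a; the remaining pair (i, l) is contracted through
   [ni] and [mm] into (b, c). *)
transitivity (\sum_q \sum_p tpure (F p q) (G p q)).
  rewrite [RHS]sum_pairs [RHS]exchange_big; apply: eq_bigr => d _.
  rewrite [LHS]sum_triple [RHS]exchange_big; apply: eq_bigr => a _.
  rewrite [RHS]pair_big -[LHS](contract_pure (m := fun q p =>
    ni p q) (r := fun p q => mm q p)) //=.
  apply: eq_bigr => -[b c] _ /=; congr tpure; rewrite [RHS]FG //.
    apply: eq_bigr => -[i l] _; rewrite tiE !block_trl //.
  by apply: eq_bigr => -[i l] _; rewrite MiE.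
(* The same contraction for T(y) T(x), read backwards: j and k are now b and c, and the contracted
   pair is (d, a). *)
rewrite key [LHS]sum_pairs; apply: eq_bigr => b _.
under eq_bigr => d _ do rewrite exchange_big.
rewrite [LHS]exchange_big [RHS]sum_triple; apply: eq_bigr => c _.
rewrite [LHS]pair_big -[RHS](contract_pure (m := fun q p =>
  ni p q) (r := fun p q => mm q p)) //=.
apply: eq_bigr => -[d a] _ /=; congr tpure; rewrite [LHS]FG' //.
  by apply: eq_bigr => -[l j] _; rewrite tiE !block_trl //.
by apply: eq_bigr => -[l j] _; rewrite MiE.
Qed.

End Commute.
(** * Power series and analytic functions *)

Section PowerSeries.
Variable K : numFieldType.

Lemma lim_dist_le (u : nat -> K) (l c b : K) (N0 : nat) : 0 <= b ->
  u @ \oo --> l -> (forall N, (N0 <= N)%N -> `|u N - c| <= b) -> `|l - c| <= b.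
Proof.
move=> b0 ul ub; apply/ler_addgt0Pl => eps eps0.
move/cvgrPdist_lt : ul => /(_ _ eps0) [N1 _ hN1].
pose N := maxn N0 N1.
have -> : l - c = (l - u N) + (u N - c) by rewrite addrA subrK.
apply: (le_trans (ler_normD _ _)); apply: lerD; last exact/ub/leq_maxl.
by apply: ltW; apply: hN1; rewrite /= leq_maxr.
Qed.

Lemma cvgn_norm_bound (u : nat -> K) : cvgn u ->
  exists2 M, 0 <= M & forall N, `|u N| <= M.
Proof.
move=> /cvg_seq_bounded /ex_strict_bound_gt0 [M M0 hM].
by exists M => [|N]; [exact: ltW|apply/ltW/hM].
Qed.

Lemma open_neq (a : K) : open [set y : K | y != a].
Proof.
rewrite openE => y /= ya; apply/nbhs_ballP.
exists `|y - a|; rewrite /= ?normr_gt0 ?subr_eq0 // => u.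
by rewrite -ball_normE /=; apply: contraTneq => ->; rewrite ltxx.
Qed.

Section SeveralVariables.
Variable n : nat.
Implicit Types (f : 'rV[K]_n -> K) (p z : 'rV[K]_n).

Lemma norm_monomial (h : 'rV[K]_n) al :
  `|monomial h al| = monomial (\row_k `|h ord0 k|) al.
Proof.
rewrite /monomial normr_prod; apply: eq_bigr => k _.
by rewrite normrX mxE.
Qed.

(** A nonconstant monomial contains some variable at least once. That occurrence gives the factor t;
    all others are bounded by rho because t <= 1. *)
Lemma monomial_shrink (h : 'rV[K]_n) (t rho : K) al : 0 <= t <= 1 -> 0 <= rho ->
  (forall k, `|h ord0 k| <= t * rho) -> al != [ffun=> 0%N] ->
  `|monomial h al| <= t * monomial (const_mx rho : 'rV[K]_n) al.
Proof.
move=> /andP[t0 t1] rho0 hh al0.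
have /existsP[k ak] : [exists k, al k != 0%N].
  apply: contraNT al0; rewrite negb_exists => /forallP h'; apply/eqP/ffunP => k.
  by rewrite ffunE; have /negbNE/eqP := h' k.
rewrite norm_monomial /monomial (bigD1 k) //= [X in _ <= _ * X](bigD1 k) //=
  mulrA.
have tr k' : 0 <= `|h ord0 k'| <= rho.
  by rewrite normr_ge0 (le_trans (hh k')) // ler_piMl.
apply: ler_pM.
- by rewrite mxE exprn_ge0.
- by apply: prodr_ge0 => k' _; rewrite mxE exprn_ge0.
- rewrite !mxE; case: (al k) ak => // m _; rewrite !exprS mulrA.
  apply: ler_pM => //; first exact: exprn_ge0.
  by rewrite lerXn2r ?nnegrE //; case/andP: (tr k).
- apply: ler_prod => k' _; rewrite !mxE exprn_ge0 //= lerXn2r ?nnegrE //.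
  by case/andP: (tr k').
Qed.

Lemma box_sum_split0 (F : {ffun 'I_n -> nat} -> K) N :
  box_sum F N.+1 = F [ffun=> 0%N] +
    \sum_(be : {ffun 'I_n -> 'I_N.+1} | be != [ffun=> ord0]) F [ffun k =>
      be k : nat].
Proof.
rewrite /box_sum (bigD1 [ffun=> ord0]) //=; congr (F _ + _).
by apply/ffunP => k; rewrite !ffunE.
Qed.

Lemma ffun_nat_eq0 N (be : {ffun 'I_n -> 'I_N.+1}) :
  ([ffun k => be k : nat] == [ffun=>
    0%N] :> {ffun 'I_n -> nat}) = (be == [ffun=> ord0]).
Proof.
apply/eqP/eqP => [h|->]; last by apply/ffunP => k; rewrite !ffunE.
by apply/ffunP => k; move/ffunP/(_ k): h; rewrite !ffunE => h; apply: val_inj.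
Qed.

Lemma nbhs_rV p (P : 'rV[K]_n -> Prop) : (\forall z \near p, P z) <->
  exists2 d : K, 0 < d & forall z, (forall k, `|p ord0 k - z ord0 k| < d) -> P
    z.
Proof.
split=> [/nbhs_ballP [d d0 hd]|[d d0 hd]].
  exists d => // z hz; apply: hd; split => // i j; rewrite ord1; exact: hz.
apply/nbhs_ballP; exists d => //= z [_ hz]; apply: hd => k; exact: hz.
Qed.

(** The constant coefficient is f p, and by [monomial_shrink] all other terms shrink by t relative
    to the absolutely convergent series at the corner of a polydisc. *)
Lemma analytic_lip f p : analytic_at f p -> exists rho M : K,
  [/\ 0 < rho, 0 <= M & forall z t, 0 <= t <= 1 ->
    (forall k, `|z ord0 k - p ord0 k| <= t * rho) -> `|f z - f p| <= t * M].
Proof.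
move=> [a /nbhs_rV [d d0 hd]].
pose rho := d / 2.
have rho0 : 0 < rho by rewrite divr_gt0.
have rhod : rho < d by rewrite ltr_pdivrMr // ltr_pMr // ltr1n.
(* The corner lies inside the region of convergence because rho = d / 2, and M bounds every box sum
   of absolute values there. *)
have [|/cvgn_norm_bound [M M0 hM] _] := hd (p + const_mx rho).
  by move=> k; rewrite !mxE opprD addrA subrr add0r normrN gtr0_norm.
pose F z al := a al * monomial (z - p) al.
have key z t : 0 <= t <= 1 -> (forall k, `|z ord0 k - p ord0 k| <= t * rho) ->
    `|f z - a [ffun=> 0%N]| <= t * M.
  move=> t01 hz; have /andP[t0 t1] := t01.
  have [|_ hf] := hd z.
    move=> k; rewrite distrC; apply: (le_lt_trans (hz k));
      apply: (le_lt_trans _ rhod).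
    by rewrite ler_piMl // ltW.
  (* The box of size 0 is empty when n > 0; the constant term is present from size 1 on. *)
  apply: (lim_dist_le (N0 := 1) _ hf); first exact: mulr_ge0.
  case=> // N _; rewrite box_sum_split0.
  have -> : monomial (z - p) [ffun=> 0%N] = 1.
    by rewrite /monomial big1 // => k _; rewrite ffunE expr0.
  rewrite mulr1 addrC addKr.
  apply: (le_trans (ler_norm_sum _ _ _)).
  apply: (le_trans _ (ler_wpM2l t0 (hM N.+1))).
  rewrite ger0_norm; last by apply: sumr_ge0.
  rewrite box_sum_split0 mulrDr mulr_sumr -[leLHS]add0r; apply: lerD.
    by rewrite mulr_ge0.
  apply: ler_sum => be be0; rewrite !normrM mulrCA; apply: ler_wpM2l => //.
  rewrite (_ : p + const_mx rho - p = const_mx rho);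
    last by rewrite addrC addKr.
  have -> : `|monomial (const_mx rho : 'rV[K]_n) [ffun k => be k : nat]| =
      monomial (const_mx rho : 'rV[K]_n) [ffun k => be k : nat].
    by rewrite ger0_norm //; apply: prodr_ge0 => k _;
      rewrite mxE exprn_ge0 // ltW.
  apply: monomial_shrink => //; first exact: ltW.
    by move=> k; rewrite !mxE; exact: hz.
  by rewrite ffun_nat_eq0.
(* The case z = p, t = 0 of [key]. *)
have fp : f p = a [ffun=> 0%N].
  apply/eqP; rewrite -subr_eq0 -normr_le0.
  rewrite -(mul0r M); apply: key; first by rewrite lexx ler01.
  by move=> k; rewrite subrr normr0 mul0r.
by exists rho, M; split=> // z t ht hz; rewrite fp; exact: key.
Qed.

Lemma analytic_cont f p : analytic_at f p -> f z @[z --> p] --> f p.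
Proof.
move=> /analytic_lip [rho [M [rho0 M0 h]]].
apply/(@cvgrPdist_lt _ _ _ _ (nbhs_filter p)) => eps eps0.
(* This t is at most 1 and makes t * M smaller than eps. *)
pose t := eps / (M + 1 + eps).
have D0 : 0 < M + 1 + eps by rewrite addr_gt0 // ltr_wpDl.
have t0 : 0 < t by rewrite divr_gt0.
have t1 : t <= 1 by rewrite ler_pdivrMr // mul1r lerDr addr_ge0.
apply/nbhs_rV; exists (t * rho); first exact: mulr_gt0.
move=> z hz; rewrite distrC; apply: (@le_lt_trans _ _ (t * M)).
  apply: h; first by rewrite ltW.
  by move=> k; rewrite distrC ltW.
rewrite /t mulrAC ltr_pdivrMr // ltr_pM2l // -addrA ltrDl.
by rewrite addr_gt0.
Qed.

End SeveralVariables.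
End PowerSeries.

(** * Isolated zeros of power series and restriction to coordinate lines *)

Section IsolatedZeros.
Variable K : numFieldType.

Definition pseries_on (c : nat -> K) (g : K -> K) (d :
  K) := forall t, `|t| < d ->
  cvgn (fun N => \sum_(k < N) `|c k * t ^+ k|) /\
  (fun N => \sum_(k < N) c k * t ^+ k) @ \oo --> g t.

(** By strong induction all coefficients vanish: if those before k do, then g(t) = c_k t^k +
    O(t^(k+1)), and zeros t arbitrarily close to 0 give |c_k| <= C |t|. *)
Lemma pseries_isolated_zeros c g d : 0 < d -> pseries_on c g d ->
  (forall eps, 0 < eps -> exists t, [/\ t != 0, `|t| < eps & g t = 0]) ->
  forall t, `|t| < d -> g t = 0.
Proof.
move=> d0 hg hz.
suff c0 k : c k = 0.
  move=> t /hg [_ ht]; apply/eqP; rewrite -normr_le0 -[g t]subr0.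
  apply: (lim_dist_le (N0 := 0) _ ht) => // N _.
  by rewrite big1 ?subrr ?normr0 // => k _; rewrite c0 mul0r.
pose rho := d / 2.
have rho0 : 0 < rho by rewrite divr_gt0.
have rhod : rho < d by rewrite ltr_pdivrMr // ltr_pMr // ltr1n.
have [|/cvgn_norm_bound [M M0 hM] _] := hg rho; first by rewrite gtr0_norm.
elim/ltn_ind: k => k IH.
apply/eqP; rewrite -normr_le0; apply/ler_addgt0Pl => eps eps0; rewrite addr0.
(* As the partial sums of |c_j| rho^j are at most M, the tail beyond degree k is at most C |t|^(k+1)
   when |t| < rho. *)
pose C := M / rho ^+ k.+1.
have C0 : 0 <= C by rewrite divr_ge0 // exprn_ge0 // ltW.
(* A zero this close satisfies both |t| < rho and C |t| <= eps. *)
have [|t [tn0 te gt]] := hz (rho * (eps / (eps + C * rho))).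
  by rewrite mulr_gt0 // divr_gt0 // ltr_wpDr // mulr_ge0 // ltW.
have D0 : 0 < eps + C * rho by rewrite ltr_wpDr // mulr_ge0 // ltW.
have tr : `|t| < rho.
  apply: (lt_le_trans te); apply: ler_piMr; first exact: ltW.
  by rewrite ler_pdivrMr // mul1r lerDl mulr_ge0 // ltW.
have [_ ht] := hg t (lt_trans tr rhod).
have tk : 0 < `|t| ^+ k by rewrite exprn_gt0 // normr_gt0.
have : `|g t - c k * t ^+ k| <= (`|t| / rho) ^+ k.+1 * M.
  have tr1 : `|t| / rho <= 1 by rewrite ler_pdivrMr // mul1r ltW.
  have tr0 : 0 <= `|t| / rho by rewrite divr_ge0 // ltW.
  apply: (lim_dist_le (N0 := k.+1) _ ht);
    first by rewrite mulr_ge0 // exprn_ge0.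
  move=> N kN; rewrite (bigD1 (Ordinal kN)) //= addrC addrK.
  apply: (le_trans (ler_norm_sum _ _ _)).
  apply: (le_trans _ (ler_wpM2l (exprn_ge0 _ tr0) (hM N))).
  rewrite [X in _ <= _ * X]ger0_norm ?sumr_ge0 // mulr_sumr [leRHS](bigD1
    (Ordinal kN)) //=.
  rewrite -[leLHS]add0r; apply: lerD; first by rewrite mulr_ge0 // exprn_ge0.
  apply: ler_sum => j; rewrite -val_eqE /= neq_ltn => /orP[jk|kj].
    by rewrite IH // !mul0r normr0 mulr0.
  rewrite !normrM mulrCA; apply: ler_wpM2l => //.
  rewrite !normrX (gtr0_norm rho0).
  have -> : `|t| ^+ j = (`|t| / rho) ^+ j * rho ^+ j.
    by rewrite -exprMn divfK // gt_eqF.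
  apply: ler_wpM2r; first by rewrite exprn_ge0 // ltW.
  exact: ler_wiXn2l.
rewrite gt sub0r normrN normrM normrX => h.
rewrite -(ler_pM2r tk); apply: (le_trans h).
have -> : (`|t| / rho) ^+ k.+1 * M = (`|t| * C) * `|t| ^+ k.
  by rewrite expr_div_n exprS /C; ring.
apply: ler_wpM2r; first exact: ltW.
apply: (le_trans (ler_wpM2r C0 (ltW te))).
have -> : rho * (eps / (eps + C * rho)) * C = eps * (C * rho) / (eps + C * rho).
  by ring.
rewrite ler_pdivrMr //.
by rewrite ler_pM2l // lerDr ltW.
Qed.

Section Lines.
Variable n : nat.
Implicit Types (f : 'rV[K]_n -> K) (p z : 'rV[K]_n).

Definition upd z (j : 'I_n) (t : K) : 'rV[K]_n :=
  \row_k (if k == j then t else z ord0 k).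

Definition axis (j : 'I_n) (k : nat) : {ffun 'I_n -> nat} :=
  [ffun i => if i == j then k else 0%N].

Lemma box_sum_axis (F : {ffun 'I_n -> nat} -> K) j N :
  (forall (al : {ffun 'I_n -> nat}) k, k != j -> al k != 0%N -> F al = 0) ->
  box_sum F N = \sum_(k < N) F (axis j k).
Proof.
(* For N = 0 the box is empty, since a multi-index would need a value at j. *)
move=> F0; rewrite /box_sum; case: N => [|N].
  by rewrite [RHS]big_ord0 big1 // => be; case: (be j).
pose P (be : {ffun 'I_n -> 'I_N.+1}) := [forall k, (k != j) ==> (be k == ord0)].
rewrite (bigID P) /= [X in _ + X]big1 ?addr0; last first.
  move=> be; rewrite negb_forall => /existsP[k];
    rewrite negb_imply => /andP[kj bek].
  by apply: (F0 _ k) => //; rewrite ffunE.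
rewrite (reindex_onto (fun k : 'I_N.+1 => [ffun i =>
  if i == j then k else ord0])
  (fun be : {ffun 'I_n -> 'I_N.+1} => be j)) /=; last first.
  move=> be /forallP hP; apply/ffunP => i; rewrite ffunE;
    case: eqP => [->//|/eqP ij].
  by have /implyP/(_ ij)/eqP := hP i.
apply: eq_big => [k|k _].
  rewrite ffunE !eqxx andbT; apply/forallP => i; apply/implyP => /negbTE ij.
  by rewrite ffunE ij.
by congr F; apply/ffunP => i; rewrite !ffunE; case: eqP.
Qed.

(** The displacement is zero off the j-th coordinate, which kills every monomial that is not a power
    of that coordinate. *)
Lemma analytic_line f p j : analytic_at f p -> exists c d,
  0 < d /\ pseries_on c (fun t => f (upd p j (p ord0 j + t))) d.
Proof.
move=> [a /nbhs_rV [d d0 hd]]; exists (fun k => a (axis j k)), d;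
  split=> // t td.
have [|] := hd (upd p j (p ord0 j + t)).
  move=> k; rewrite mxE; case: eqP => [->|_]; last by rewrite subrr normr0.
  by rewrite opprD addrA subrr add0r normrN.
have mono_axis k : monomial (upd p j (p ord0 j + t) - p) (axis j k) = t ^+ k.
  rewrite /monomial (bigD1 j) //= !mxE eqxx ffunE eqxx addrC addKr big1 ?mulr1
    //.
  by move=> i /negbTE ij; rewrite ffunE ij expr0.
have mono0 (al : {ffun 'I_n -> nat}) k : k != j -> al k != 0%N ->
    monomial (upd p j (p ord0 j + t) - p) al = 0.
  move=> kj ak; rewrite /monomial (bigD1 k) //= !mxE (negbTE kj) subrr.
  by rewrite expr0n (negbTE ak) mul0r.
set F1 := box_sum _; set F2 := box_sum _.
have -> : F1 = (fun N => \sum_(k < N) `|a (axis j k) * t ^+ k|).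
  apply/funext => N; rewrite /F1 (box_sum_axis (j := j)).
    by apply: eq_bigr => k _; rewrite mono_axis.
  by move=> al k kj ak; rewrite (mono0 _ _ kj ak) mulr0 normr0.
have -> : F2 = (fun N => \sum_(k < N) a (axis j k) * t ^+ k).
  apply/funext => N; rewrite /F2 (box_sum_axis (j := j)).
    by apply: eq_bigr => k _; rewrite mono_axis.
  by move=> al k kj ak; rewrite (mono0 _ _ kj ak) mulr0.
by [].
Qed.

End Lines.
End IsolatedZeros.

(** * Connectedness and the identity theorem along complex segments *)

Section Segments.
Variable R : realType.
Local Notation K := [the numFieldType of R[i]].

(** The preimage of P in [0, 1] is nonempty, open and closed, hence everything. Closedness of P is
    asked only along the curve. *)
Lemma segment_clopen (T : topologicalType) (g : R -> T) (P : set T) :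
  continuous g -> open P ->
  (forall s, 0 <= s <= 1 -> closure P (g s) -> P (g s)) -> P (g 0) -> P (g 1).
Proof.
move=> gc oP cP P0.
pose B := `[0, 1]%classic `&` g @^-1` P.
have BE : B = `[0, 1]%classic.
  apply: (segment_connected (a := 0) (b := 1)).
  - by exists 0; split=> //=; rewrite in_itv /= lexx ler01.
  - by exists (g @^-1` P) => //; apply: open_comp => // s _; exact: gc.
  - exists (g @^-1` closure P).
      by apply: closed_comp; [move=> s _; exact: gc|exact: closed_closure].
    apply/seteqP; split=> s /= [s01 Ps]; split=> //.
      exact: subset_closure.
    by apply: cP => //; move: s01; rewrite /= in_itv.
have : B 1 by rewrite BE /= in_itv /= lexx ler01.
by case.
Qed.

Lemma real_complex_cont : continuous (fun s : R => s%:C%C : K).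
Proof.
move=> s; apply/cvgrPdist_lt => eps eps0.
(* A positive complex number is real, so eps is its real part [er]. *)
case: eps eps0 => er ei; rewrite ltcE /= => /andP[/eqP -> er0].
near=> t.
rewrite -rmorphB /= normc_def /= expr0n /= addr0 sqrtr_sqr -[ltRHS]/(er%:C%C)
  ltcR.
near: t; exact: cvgr_dist_lt.
Unshelve. all: by end_near. Qed.

Definition segpt (a b : K) (s : R) : K := a + s%:C%C * (b - a).

Lemma segpt0 a b : segpt a b 0 = a.
Proof. by rewrite /segpt rmorph0 mul0r addr0. Qed.

Lemma segpt1 a b : segpt a b 1 = b.
Proof. by rewrite /segpt rmorph1 mul1r addrC subrK. Qed.

Lemma segpt_cont a b : continuous (segpt a b).
Proof.
move=> s; apply: cvgD; first exact: cvg_cst.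
by apply: cvgM; [exact: real_complex_cont|exact: cvg_cst].
Qed.

Lemma segpt_rV_cont n (p q : 'rV[K]_n) :
  continuous (fun s => \row_k segpt (p ord0 k) (q ord0 k) s : 'rV[K]_n).
Proof.
move=> s P /nbhs_rV [d d0 hd].
have : \forall t \near s, forall k, `|segpt (p ord0 k) (q ord0 k) s - segpt (p
  ord0 k) (q ord0 k) t| < d.
  apply: (@filter_forall _ _ (fun k t =>
    `|segpt (p ord0 k) (q ord0 k) s - segpt (p ord0 k) (q ord0 k) t| < d) _
      (nbhs_filter s)) => k.
  by have /cvgrPdist_lt := @segpt_cont (p ord0 k) (q ord0 k) s; apply.
by apply: filterS => t ht; apply: hd => k; rewrite !mxE; exact: ht.
Qed.

(** Balls are convex. The strict inequality comes from the term with weight s, so s = 0 is treated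
    apart. *)
Lemma segpt_ball (p a b d : K) s :
  0 <= s <= 1 -> `|p - a| < d -> `|p - b| < d ->
  `|p - segpt a b s| < d.
Proof.
move=> /andP[s0 s1] pa pb.
have -> : p - segpt a b s = (1 - s%:C%C) * (p - a) + s%:C%C * (p - b).
  by rewrite /segpt; ring.
have sC0 : 0 <= s%:C%C :> K by rewrite -[0]/(0%:C%C) lecR.
have sC1 : 0 <= 1 - s%:C%C :> K by rewrite subr_ge0 -[1]/(1%:C%C) lecR.
apply: (le_lt_trans (ler_normD _ _));
  rewrite !normrM (ger0_norm sC0) (ger0_norm sC1).
have [->|sn0] := eqVneq s 0.
  by rewrite rmorph0 subr0 mul1r mul0r addr0.
have sp : 0 < s%:C%C :> K by rewrite -[0]/(0%:C%C) ltcR lt_neqAle eq_sym sn0.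
have -> : d = (1 - s%:C%C) * d + s%:C%C * d by ring.
apply: ler_ltD; first by apply: ler_wpM2l => //; exact: ltW.
by rewrite ltr_pM2l.
Qed.

Lemma nbhs_other (P : set K) (t u : K) : nbhs t P -> exists2 t', t' != u & P t'.
Proof.
have [->|tu] := eqVneq t u; last by move=> /nbhs_singleton Pt; exists t.
move=> /nbhs_ballP [d /= d0 hd]; exists (u + d / 2).
  by rewrite -subr_eq0 addrC addKr gt_eqF // divr_gt0.
apply: hd; rewrite -ball_normE /= opprD addrA subrr add0r normrN gtr0_norm
  ?divr_gt0 //.
by rewrite ltr_pdivrMr // ltr_pMr // ltr1n.
Qed.

(** The interior of the zero set is open. A point of the segment in its closure is a limit of zeros,
    so h vanishes on a whole disc around it, and connectedness concludes. *)
Lemma segment_identity (h : K -> K) a b :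
  (forall s, 0 <= s <= 1 -> exists c d, 0 < d /\
     pseries_on c (fun t => h (segpt a b s + t)) d) ->
  (\forall t \near a, h t = 0) -> h b = 0.
Proof.
move=> hs ha.
pose Z := [set t | h t = 0]^°.
suff : Z b by exact: nbhs_singleton.
rewrite -(segpt1 a b); apply: (segment_clopen (@segpt_cont a b)).
- exact: open_interior.
- move=> s s01 cl; have [c [d [d0 hser]]] := hs s s01.
  have hz t : `|t| < d -> h (segpt a b s + t) = 0.
    apply: (pseries_isolated_zeros d0 hser) => eps eps0.
    have [|x [Zx xe]] := cl (ball (segpt a b s) eps).
      exact: nbhsx_ballx.
    (* The point supplied by the closure may be the centre itself; it is moved to another point of
       the open set Z. *)
    have [y yne [Zy ye]] : exists2 y, y != segpt a b s & (Z `&` ball (segpt a b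
      s) eps) y.
      apply: (@nbhs_other _ x); apply: filterI.
        exact: (open_nbhs_nbhs (conj (@open_interior _ _) Zx)).
      exact: (open_nbhs_nbhs (conj (ball_open _ _) xe)).
    exists (y - segpt a b s); split; first by rewrite subr_eq0.
      by rewrite distrC.
    by rewrite addrC subrK; exact: nbhs_singleton Zy.
  apply/nbhs_ballP; exists d => //= y; rewrite -ball_normE /= distrC => /hz.
  by rewrite addrC subrK.
by rewrite segpt0; exact: ha.
Qed.

End Segments.
(** * Generic points *)

Section GenericPoints.
Variable R : realType.
Local Notation K := [the numFieldType of R[i]].

Section SeveralVariables.
Variable n : nat.
Implicit Types (f : 'rV[K]_n -> K) (p q r z : 'rV[K]_n) (A Omega :
  set 'rV[K]_n).

(* The coordinates are moved one at a time: along a coordinate line, the box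
   sums are the partial sums of a power series in one variable. *)
Lemma analytic_identity f p r (d eps : K) : 0 < eps ->
  (forall z, (forall k, `|p ord0 k - z ord0 k| < d) -> analytic_at f z) ->
  (forall k, `|p ord0 k - r ord0 k| < d) ->
  (forall z, (forall k, `|p ord0 k - z ord0 k| < d) ->
     (forall k, `|r ord0 k - z ord0 k| < eps) -> f z = 0) ->
  forall z, (forall k, `|p ord0 k - z ord0 k| < d) -> f z = 0.
Proof.
move=> e0 fan pr f0.
(* In [key j] the coordinates of index below j range over the whole polydisc, and the others stay
   within eps of those of r. *)
suff key (j : nat) : (j <= n)%N -> forall z, (forall k, `|p ord0 k - z ord0 k|
  < d) ->
    (forall k : 'I_n, (j <= k)%N -> `|r ord0 k - z ord0 k| < eps) -> f z = 0.
  by move=> z zd; apply: (key n) => // k; rewrite leqNgt ltn_ord.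
elim: j => [_ z zd zr|j IH jn z zd zr]; first by apply: f0 => // k; exact: zr.
pose jo := Ordinal jn.
have updE t : (upd z jo t) ord0 jo = t by rewrite mxE eqxx.
have updU t u : upd (upd z jo t) jo u = upd z jo u.
  by apply/rowP => k; rewrite !mxE; case: eqP.
have updB t : `|p ord0 jo - t| < d -> forall k, `|p ord0 k - (upd z jo t) ord0
  k| < d.
  by move=> td k; rewrite mxE; case: eqP => [->|].
have -> : z = upd z jo (z ord0 jo).
  by apply/rowP => k; rewrite mxE; case: eqP => [->|].
apply: (@segment_identity _ (fun t => f (upd z jo t)) (r ord0 jo)).
  move=> s s01; set x := segpt _ _ s.
  have [|c [d' [d'0 h]]] := @analytic_line _ _ f (upd z jo x) jo.
    by apply/fan/updB/segpt_ball.
  exists c, d'; split; first exact: d'0.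
  suff <- : (fun t => f (upd (upd z jo x) jo ((upd z jo x) ord0 jo + t))) =
      (fun t => f (upd z jo (x + t))) by exact: h.
  by apply/funext => t; rewrite updE updU.
have nd : nbhs (r ord0 jo) (ball (p ord0 jo) d).
  have bpr : ball (p ord0 jo) d (r ord0 jo) by exact: pr.
  exact: (open_nbhs_nbhs (conj (ball_open _ _) bpr)).
have ne : nbhs (r ord0 jo) (ball (r ord0 jo) eps) by exact: nbhsx_ballx.
apply: filterS (filterI nd ne) => t [td te].
apply: IH; [exact: ltnW|exact: updB|].
move=> k; rewrite leq_eqVlt => /orP[/eqP jk|jk].
  by have -> : k = jo; [apply: val_inj|rewrite updE].
rewrite mxE; case: eqP => [kj|_]; last exact: zr.
by move: jk; rewrite kj ltnn.
Qed.

(** On a polydisc around p, A is a common zero set. The polydisc meets the interior of A, so each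
    defining function vanishes on an open part of it and, by [analytic_identity], on all of it. *)
Lemma analytic_interior_closed Omega A p : analytic_subset Omega A ->
  Omega p -> closure A° p -> A° p.
Proof.
move=> [_ hA] Op clp; have [m [f /nbhs_rV [d d0 hd]]] := hA p Op.
have [r [Ar pr]] : exists r, A° r /\ forall k, `|p ord0 k - r ord0 k| < d.
  have [|r [Ar pr]] := clp [set z | forall k, `|p ord0 k - z ord0 k| < d].
    by apply/nbhs_rV; exists d.
  by exists r.
have /nbhs_rV [eps e0 he] : \forall z \near r, A z by [].
apply/nbhs_rV; exists d => // z zd; apply/(hd z zd).2 => i.
apply: (analytic_identity e0 _ pr) zd => [z' zd'|z' zd' ze'].
  exact: (hd z' zd').1.
by have [_ [Az _]] := hd z' zd'; apply: Az; exact: he.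
Qed.

Lemma analytic_segment Omega A p q : analytic_subset Omega A ->
  (forall s, 0 <= s <= 1 -> Omega (\row_k segpt (p ord0 k) (q ord0 k) s)) ->
  A° p -> A° q.
Proof.
move=> hA hO Ap.
have rq : q = \row_k segpt (p ord0 k) (q ord0 k) 1 by apply/rowP => k;
  rewrite mxE segpt1.
have rp : p = \row_k segpt (p ord0 k) (q ord0 k) 0 by apply/rowP => k;
  rewrite mxE segpt0.
rewrite rq; apply: (@segment_clopen _ _ _ A° (@segpt_rV_cont R n p q)).
- exact: open_interior.
- by move=> s s01; apply: analytic_interior_closed hA _; exact: hO.
by rewrite -rp.
Qed.

(** Some defining function is nonzero at p, hence also nearby by continuity. *)
Lemma analytic_subset_compl Omega A p : analytic_subset Omega A ->
  Omega p -> ~ A p -> \forall z \near p, ~ A z.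
Proof.
move=> [_ hA] Op Ap; have [m [f hf]] := hA p Op.
have [fan fA] := nbhs_singleton hf.
have [i fi] : exists i, f i p != 0.
  apply: contra_notP Ap => h; apply/fA => i; apply/eqP/negPn/negP => fi.
  by apply: h; exists i.
have /analytic_cont/(_ [set u | u != 0]) := fan i.
have oK : nbhs (f i p) [set u : K | u != 0].
  exact: (open_nbhs_nbhs (conj (@open_neq _ 0) fi)).
move=> /(_ oK) h; apply: filterS (filterI hf h) =>
  z [[_ Az] /= fz] /Az /(_ i) fz0.
by rewrite fz0 eqxx in fz.
Qed.

(** If N lay inside A, then p and therefore q would be interior to A. The implication from p to q is
    where connectedness of the domain enters. *)
Lemma analytic_generic_near Omega A p q (N : set 'rV[K]_n) :
  analytic_subset Omega A -> ~ A q -> (A° p -> A° q) -> nbhs p N ->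
  N `<=` Omega -> exists2 z, N z & \forall z' \near z, ~ A z'.
Proof.
move=> hA Aq pq Np NO.
have [z [Nz Az]] : exists z, N z /\ ~ A z.
  apply: contrapT => h; apply: Aq; apply: interior_subset; apply: pq.
  apply: filterS Np => z Nz; apply: contrapT => Az.
  by apply: h; exists z.
by exists z => //; apply: (analytic_subset_compl hA) => //; exact: NO.
Qed.

End SeveralVariables.

(* [P] holds on a set with dense interior; mere density would not be stable
   under conjunction. *)
Definition densely (P : K -> Prop) := forall U : set K, open U -> U !=set0 ->
  exists U' : set K, [/\ open U', U' !=set0, U' `<=` U & forall x, U' x -> P x].

Definition densely2 (P : K -> K -> Prop) := forall U V : set K,
  open U -> U !=set0 -> open V -> V !=set0 ->
  exists U' V' : set K, [/\ open U' /\ U' !=set0, open V' /\ V' !=set0,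
    U' `<=` U, V' `<=` V & forall x y, U' x -> V' y -> P x y].

Lemma densely2_and P Q : densely2 P -> densely2 Q -> densely2 (fun x y =>
  P x y /\ Q x y).
Proof.
move=> hP hQ U V oU U0 oV V0.
have [U1 [V1 [[oU1 U10] [oV1 V10] UU1 VV1 P1]]] := hP U V oU U0 oV V0.
have [U2 [V2 [hU2 hV2 UU2 VV2 Q2]]] := hQ U1 V1 oU1 U10 oV1 V10.
exists U2, V2; split=> //.
- exact: subset_trans UU1.
- exact: subset_trans VV1.
by move=> x y Ux Vy; split; [apply: P1; [exact: UU2|exact: VV2]|exact: Q2].
Qed.

Lemma densely_and P Q : densely P -> densely Q -> densely (fun x => P x /\ Q x).
Proof.
move=> hP hQ U oU U0.
have [U1 [oU1 U10 UU1 P1]] := hP U oU U0.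
have [U2 [oU2 U20 UU2 Q2]] := hQ U1 oU1 U10.
exists U2; split=> //; first exact: subset_trans UU1.
by move=> x Ux; split; [apply/P1/UU2|exact: Q2].
Qed.

Lemma densely_left P : densely P -> densely2 (fun x _ => P x).
Proof.
move=> hP U V oU U0 oV V0; have [U1 [oU1 U10 UU1 P1]] := hP U oU U0.
by exists U1, V; split=> // x y /P1.
Qed.

Lemma densely_right P : densely P -> densely2 (fun _ y => P y).
Proof.
move=> hP U V oU U0 oV V0; have [V1 [oV1 V10 VV1 P1]] := hP V oV V0.
by exists U, V1; split=> // x y _ /P1.
Qed.

(* Only [x] is moved, at a fixed [y] where the map [x |-> x * g y] is open. *)
Lemma densely_mul (P : K -> Prop) (g : K -> K) :
  (forall y, y != 0 -> g y != 0 /\ {for y, continuous g}) ->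
  densely P -> densely2 (fun x y => P (x * g y)).
Proof.
move=> hg hP U V oU [x Ux] oV [y Vy].
have [y1 y10 Vy1] := @nbhs_other _ V y 0 (open_nbhs_nbhs (conj oV Vy)).
have [gy0 gc] := hg y1 y10.
pose W := [set w : K | U (w / g y1)].
have oW : open W.
  have cW : continuous (fun w : K => w / g y1).
    exact: mulrr_continuous.
  by apply: (@open_comp K K _ U _ oU) => w _; exact: cW.
have [|W1 [oW1 [w W1w] WW1 P1]] := hP W oW.
  by exists (x * g y1); rewrite /W /= mulfK.
pose x1 := w / g y1.
have W1x : W1 (x1 * g y1) by rewrite divfK.
(* Joint continuity of multiplication gives a product of neighbourhoods that it maps into W1. *)
have [[U1 B] /= [nU1 nB] UB1] : nbhs (x1, g y1) ((fun z :
  K * K => z.1 * z.2) @^-1` W1).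
  by apply: mul_continuous; exact: open_nbhs_nbhs.
pose V1 := g @^-1` B; have nV1 : nbhs y1 V1 by exact: gc.
exists (U1° `&` U), (V1° `&` V); split.
- split; first by apply: openI => //; exact: open_interior.
  by exists x1; split=> //; exact: WW1.
- split; first by apply: openI => //; exact: open_interior.
  by exists y1.
- by move=> ? [].
- by move=> ? [].
move=> u v [Uu _] [Vv _]; apply: P1.
have U1u : U1 u := interior_subset Uu.
have V1v : V1 v := interior_subset Vv.
exact: (UB1 (u, g v)).
Qed.

Lemma densely2_near (P : K -> K -> Prop) (x0 y0 : K) (U V : set K) :
  densely2 P ->
  nbhs x0 U -> nbhs y0 V -> exists x y, [/\ U x, V y & P x y].
Proof.
move=> hP nU nV; have [||||U' [V' [[_ [x Ux]] [_ [y Vy]] UU VV P']]] := hP U°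
  V°.
- exact: open_interior.
- by exists x0.
- exact: open_interior.
- by exists y0.
exists x, y; split; [exact: (interior_subset (UU _ Ux))|exact:
  (interior_subset (VV _ Vy))|exact: P'].
Qed.

Lemma generic1_densely (P : K -> Prop) : generic1 P -> densely P.
Proof.
move=> [A [hA [_ AT] hP]] U oU [x Ux].
have [q Aq] : exists q, ~ A q.
  by apply: contrapT => h; apply: AT => q _; apply: contrapT => Aq; apply: h;
    exists q.
have [||//|z Uz /nbhs_rV [d d0 hd]] := @analytic_generic_near _ setT A
  (const_mx x) q [set z | U (z ord0 ord0)] hA Aq.
(* The whole plane is convex, so one segment joins the two points. *)
- by apply: (analytic_segment hA).
- apply/nbhs_rV; have /nbhs_ballP [d /= d0 hd] := open_nbhs_nbhs (conj oU Ux).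
  by exists d => // z hz; apply: hd; have := hz ord0; rewrite mxE.
exists (U `&` ball (z ord0 ord0) d); split.
- by apply: openI => //; exact: ball_open.
- by exists (z ord0 ord0); split=> //; exact: ballxx.
- by move=> ? [].
move=> u [Uu ud]; have := hP (const_mx u) I; rewrite !mxE; apply.
by apply: hd => k; rewrite mxE (ord1 k).
Qed.

Lemma real_imag_eq0 (a b : R) :
  a%:C%C + b%:C%C * 'i%C = 0 :> K -> a = 0 /\ b = 0.
Proof.
by move=> /eqP; rewrite eq_complex /= !(mul0r, mulr0, mulr1, subr0, addr0,
  add0r) => /andP[/eqP -> /eqP ->].
Qed.

(** Two points with nonzero second coordinates are joined by one segment, or by two when these
    coordinates lie on opposite rays from 0. *)
Lemma analytic_connected (A : set 'rV[K]_2) (p q : 'rV[K]_2) :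
  analytic_subset [set z | z ord0 ord_max != 0] A ->
  p ord0 ord_max != 0 -> q ord0 ord_max != 0 -> A° p -> A° q.
Proof.
move=> hA p0 q0; set a := p ord0 ord_max in p0; set b := q ord0 ord_max in q0.
have [h|] := pselect (forall s, 0 <= s <= 1 -> segpt a b s != 0).
  by apply: (analytic_segment hA) => s s01; rewrite /= mxE; exact: h.
move=> /existsNP [s /not_implyP [/andP[s0 s1] /negP/negPn/eqP hs]].
(* The segment from [a] to [b] meets 0, so go through ['i * a] instead. *)
pose r : 'rV[K]_2 := \row_k (if k == ord_max then 'i%C * a else q ord0 k).
move=> Ap; have : A° r.
  apply: (analytic_segment hA _ Ap) => u u01; rewrite /= !mxE /= -/a.
  apply/negP => /eqP h.
  have /eqP : a * ((1 - u)%:C%C + u%:C%C * 'i%C) = 0.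
    by rewrite -h /segpt rmorphB rmorph1; ring.
  rewrite mulf_eq0 (negbTE p0) /= => /eqP/real_imag_eq0 [/eqP].
  by rewrite subr_eq0 => /eqP <- /eqP; rewrite oner_eq0.
apply: (analytic_segment hA) => u u01; rewrite /= !mxE /= -/b.
have sn0 : s != 0 by apply: contraNneq p0 => s00; move: hs;
  rewrite s00 segpt0 => ->.
have sC0 : s%:C%C != 0 :> K by rewrite -[0]/(0%:C%C) (inj_eq (@complexI _)).
(* From (1 - s) a + s b = 0 comes b = - mu a, so the second leg consists of the points a (- u mu +
   (1 - u) i). A zero would force u = 1 and mu = 0, hence b = 0. *)
pose mu := (1 - s) / s.
have bE : b = - mu%:C%C * a.
  have : s%:C%C * b = - (1 - s)%:C%C * a.
    apply/eqP; rewrite -subr_eq0 -hs /segpt rmorphB rmorph1; apply/eqP; ring.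
  move=> h; rewrite -[LHS](mulKf sC0) h /mu fmorph_div; ring.
apply/negP => /eqP h.
have /eqP : a * ((- u * mu)%:C%C + (1 - u)%:C%C * 'i%C) = 0.
  by rewrite -h /segpt bE rmorphM rmorphN rmorphB rmorph1; ring.
rewrite mulf_eq0 (negbTE p0) /= => /eqP/real_imag_eq0 [/eqP + /eqP].
rewrite subr_eq0 => + /eqP u1; rewrite -u1 mulN1r oppr_eq0 => /eqP mu0.
by move: q0; rewrite bE mu0 rmorph0 oppr0 mul0r eqxx.
Qed.

Lemma generic2_densely (P : K -> K -> Prop) : generic2 P -> densely2 P.
Proof.
move=> [A [hA [AO OA] hP]] U V oU [x Ux] oV [y0 Vy0].
(* The ambient domain omits y = 0, so the second coordinate is first moved away from it. *)
have [y yn0 Vy] := @nbhs_other _ V y0 0 (open_nbhs_nbhs (conj oV Vy0)).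
have [q [Oq Aq]] : exists q : 'rV[K]_2, q ord0 ord_max != 0 /\ ~ A q.
  apply: contrapT => h; apply: OA => q Oq; apply: contrapT => Aq; apply: h.
  by exists q.
have oV' : open (V `&` [set v : K | v != 0]).
  by apply: openI => //; exact: open_neq.
pose p : 'rV[K]_2 := \row_k (if k == ord_max then y else x).
have p1 : p ord0 ord_max = y by rewrite mxE eqxx.
have p00 : p ord0 ord0 = x by rewrite mxE.
have [|||z [Uz [Vz z0]] /nbhs_rV [d d0 hd]] := @analytic_generic_near _ _ A p q
    [set z | U (z ord0 ord0) /\ (V `&` [set v | v != 0]) (z ord0 ord_max)] hA
      Aq.
- by apply: (analytic_connected hA) => //; rewrite p1.
- have /nbhs_ballP [d1 /= d10 hd1] := open_nbhs_nbhs (conj oU Ux).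
  have /nbhs_ballP [d2 /= d20 hd2] := open_nbhs_nbhs (conj oV' (conj Vy yn0)).
  have n0 : nbhs p [set z : 'rV[K]_2 | U (z ord0 ord0)].
    by apply/nbhs_rV; exists d1 => // z hz; apply: hd1; rewrite -p00; exact: hz.
  have n1 : nbhs p [set z : 'rV[K]_2 | (V `&` [set v | v != 0]) (z ord0
    ord_max)].
    by apply/nbhs_rV; exists d2 => // z hz; apply: hd2; rewrite -p1; exact: hz.
  exact: filterS (filterI n0 n1).
- by move=> z [_ []].
exists (U `&` ball (z ord0 ord0) d), (V `&` [set v | v != 0] `&` ball (z ord0
  ord_max) d).
split.
- split; first by apply: openI => //; exact: ball_open.
  by exists (z ord0 ord0); split=> //; exact: ballxx.
- split; first by apply: openI => //; exact: ball_open.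
  by exists (z ord0 ord_max); split=> //; exact: ballxx.
- by move=> ? [].
- by move=> ? [[]].
move=> u v [Uu ud] [[Vv v0] vd].
pose w : 'rV[K]_2 := \row_k (if k == ord_max then v else u).
have := hP w; rewrite !mxE /=; apply; first by rewrite !mxE.
apply: hd => k; rewrite mxE; case: eqP => [->//|/eqP kn].
have -> : k = ord0; last by [].
apply/val_inj; case: k kn => -[|[|]] //.
Qed.

End GenericPoints.
(** * From generic points to the whole domain *)

Section Limits.
Variables (K : numFieldType) (A : lmodType K).

(* The linear relations between finitely many vectors of [A] form a closed set
   of coefficients, although [A] itself carries no topology. *)
Lemma relation_limit (Z : Type) (F : set_system Z) (FF : Filter F) (I : Type)
    (s : seq I) (v : I -> A) (c : I -> Z -> K) (l : I -> K) :
  (forall i, c i z @[z --> F] --> l i) ->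
  (forall P, F P -> exists z, P z /\ \sum_(i <- s) c i z *: v i = 0) ->
  \sum_(i <- s) l i *: v i = 0.
Proof.
elim: s c l => [|i0 s IH] c l cl hc; first by rewrite big_nil.
(* Either v i0 is a combination of the remaining vectors and its coefficient is distributed over
   them, or its coefficient is 0 in every relation and hence in the limit. *)
have [[d vd]|nspan] := pselect (exists d : I -> K, v i0 = \sum_(i <- s) d i *:
  v i).
  have comb (a : I -> K) : \sum_(i <- i0 :: s) a i *: v i =
      \sum_(i <- s) (a i + a i0 * d i) *: v i.
    rewrite big_cons vd scaler_sumr -big_split; apply: eq_bigr => i _.
    by rewrite /= scalerDl scalerA addrC.
  rewrite comb; apply: (IH (fun i z => c i z + c i0 z * d i)).
    by move=> i; apply: cvgD => //; exact: cvgMr_tmp.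
  by move=> P /hc [z [Pz hz]]; exists z; split=> //; rewrite -(comb (c^~ z)).
have zero (a : I -> K) : \sum_(i <- i0 :: s) a i *: v i = 0 ->
    a i0 = 0 /\ \sum_(i <- s) a i *: v i = 0.
  rewrite big_cons => h; have [a0|an0] := eqVneq (a i0) 0.
    by move: h; rewrite a0 scale0r add0r.
  exfalso; apply: nspan; exists (fun i => - (a i0)^-1 * a i).
  under eq_bigr do rewrite -scalerA; rewrite -scaler_sumr.
  move/eqP: h; rewrite addrC addr_eq0 => /eqP ->.
  by rewrite scaleNr scalerN opprK scalerA mulVf // scale1r.
rewrite big_cons (IH c) //; last first.
  by move=> P /hc [z [Pz /zero[_ hz]]]; exists z.
suff -> : l i0 = 0 by rewrite scale0r addr0.
apply/eqP/negPn/negP => ln0.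
have /cvgrPdist_lt/(_ `|l i0|) := cl i0;
  rewrite normr_gt0 => /(_ ln0) /hc [z [hz /zero [cz _]]].
by move: hz; rewrite cz subr0 ltxx.
Qed.

Lemma analytic1_cont (f : K -> K) x :
  analytic1_at f x -> f z @[z --> x] --> f x.
Proof.
move=> /analytic_cont fc P Pfx.
have /fc /nbhs_rV [d d0 hd] : nbhs (f ((const_mx x :
  'rV[K]_1) ord0 ord0)) P by rewrite mxE.
apply/nbhs_ballP; exists d => //= z hz; have := hd (const_mx z);
  rewrite /= mxE; apply.
by move=> k; rewrite !mxE.
Qed.

Lemma expansion_lin m (f : 'I_m -> K -> K) (X : 'I_m -> {linear A -> A}) z :
  linear (expansion f X z).
Proof.
move=> a u w; rewrite /expansion scaler_sumr -big_split;
  apply: eq_bigr => i _ /=.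
by rewrite linearP scalerDr !scalerA mulrC.
Qed.

End Limits.

Section DomainValues.
Variable R : realType.
Local Notation K := [the numFieldType of R[i]].

Lemma densely_neq (x0 : K) : densely (fun x => x != x0).
Proof.
move=> U oU [x Ux].
have [x' x'n Ux'] := @nbhs_other _ U x x0 (open_nbhs_nbhs (conj oU Ux)).
exists (U `&` [set y | y != x0]); split.
- by apply: openI => //; exact: open_neq.
- by exists x'.
- by move=> ? [].
- by move=> y [].
Qed.

Lemma Mer_densely_linear (A : lmodType K) (F : K -> A -> A) :
  Mer F -> densely (fun x => linear (F x)).
Proof.
move=> [m [f [X [_ /generic1_densely h]]]] U oU U0.
have [U' [oU' U'0 UU P]] := h U oU U0; exists U'; split=> // x /P FE.
by move=> a u w; rewrite !FE; exact: expansion_lin.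
Qed.

Lemma mvalP (A : lmodType K) (T : K -> A -> A) (x0 : K) : dom T x0 ->
  exists G, holomorphic_ext T x0 G /\ mval T x0 = G x0.
Proof.
move=> hx; exists (xget T [set G | holomorphic_ext T x0 G]); split=> //.
exact: (xgetPex T hx).
Qed.

(** Applied to a, the commutator is a sum of f_i(x) f'_j(y) times fixed vectors, so [relation_limit]
    carries its vanishing to (x0, y0). *)
Lemma mval_commute (A : lmodType K) (T : K -> A -> A) (x0 y0 : K) :
  densely2 (fun x y => T x \o T y =1 T y \o T x) ->
  dom T x0 -> dom T y0 -> mval T x0 \o mval T y0 =1 mval T y0 \o mval T x0.
Proof.
move=> hT /mvalP [G [[[m [f [X [fan GE]]]] TG] ->]].
move=> /mvalP [H [[[m' [f' [X' [fan' HE]]]] TH] ->]] a /=.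
have GE0 := nbhs_singleton GE; have HE0 := nbhs_singleton HE.
rewrite !GE0 !HE0.
have EE (x y : K) b : expansion f X x (expansion f' X' y b) =
    \sum_(p : 'I_m * 'I_m') (f p.1 x * f' p.2 y) *: X p.1 (X' p.2 b).
  rewrite /expansion -(pair_big xpredT xpredT (fun i j => (f i x * f' j y) *:
    X i (X' j b))) /=.
  apply: eq_bigr => i _; rewrite linear_sum scaler_sumr; apply: eq_bigr => j _.
  by rewrite linearZ scalerA.
have EE' (x y : K) b : expansion f' X' y (expansion f X x b) =
    \sum_(p : 'I_m * 'I_m') (f p.1 x * f' p.2 y) *: X' p.2 (X p.1 b).
  rewrite /expansion -(pair_big xpredT xpredT (fun i j => (f i x * f' j y) *:
    X' j (X i b))) /=.
  rewrite exchange_big /=.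
  apply: eq_bigr => i _; rewrite linear_sum scaler_sumr; apply: eq_bigr => j _.
  by rewrite linearZ scalerA mulrC.
pose v (p : 'I_m * 'I_m') := X p.1 (X' p.2 a) - X' p.2 (X p.1 a).
have comm (x y : K) : expansion f X x (expansion f' X' y a) -
   expansion f' X' y (expansion f X x a) = \sum_p (f p.1 x * f' p.2 y) *: v p.
  by rewrite EE EE' -sumrB; apply: eq_bigr => p _; rewrite scalerBr.
apply/eqP; rewrite -subr_eq0 comm; apply/eqP.
apply: (@relation_limit _ _ _ _ (nbhs_filter (x0, y0)) _ _ v
  (fun p z => f p.1 z.1 * f' p.2 z.2)).
  move=> p; apply: (@cvgM K _ _ (nbhs_filter (x0, y0))).
    by apply: (cvg_comp _ _ (@cvg_fst _ _ (nbhs x0) (nbhs y0) _));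
      exact: analytic1_cont.
  by apply: (cvg_comp _ _ (@cvg_snd _ _ (nbhs x0) (nbhs y0) _));
    exact: analytic1_cont.
move=> P [[U V] /= [nU nV] UV].
(* T agrees with its extensions only on punctured neighbourhoods, so x0 and y0 themselves are
   avoided. *)
have hT' := densely2_and hT (densely2_and (densely_left (densely_neq x0))
  (densely_right (densely_neq y0))).
have [x [y [[Ux [GEx TGx]] [Vy [HEy THy]] [TT [xn yn]]]]] := densely2_near hT'
  (filterI nU (filterI GE TG)) (filterI nV (filterI HE TH)).
exists (x, y); split; first exact: UV.
rewrite /= -comm -GEx -HEy -HEy -GEx.
have := TT a; rewrite /= (TGx xn) (THy yn) (TGx xn) (THy yn) => ->.
by rewrite subrr.
Qed.

End DomainValues.

(* In the two relations the factors 0, 0', 1 are the legs 1, 2, 3. *)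
Theorem theorem2p4 (R : realType) (V : vectType R[i]) (n : nat)
    (e : n.-tuple V) (he : basis_of fullv e) (Wp Wm : lmodType R[i])
    (Up : R[i] -> tens V Wp -> tens V Wp)
    (Um : R[i] -> tens V Wm -> tens V Wm)
    (hUp : Mer Up) (hUm : Mer Um)
    (Rm : R[i] -> tens V V -> tens V V)
    (hR : Mer_unit Rm) (hRt : Mer_unit (fun x => trl e (Rm x)))
    (right_reflection : generic2 (fun x y : R[i] =>
       leg21 (Rm (x / y)) \o leg13 (Um x) \o leg12 (Rm (x * y))
         \o leg23 (Um y)
       =1 leg23 (Um y) \o leg21 (Rm (x * y)) \o leg13 (Um x)
         \o leg12 (Rm (x / y))))
    (dual_reflection : generic2 (fun x y : R[i] =>
       leg21 (tr_full e (invop (Rm (x / y)))) \o leg13 (trl e (Up x))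
         \o leg12 (tr_full e (tildeop e (Rm (x * y))))
         \o leg23 (trl e (Up y))
       =1 leg23 (trl e (Up y))
         \o leg21 (tr_full e (tildeop e (Rm (x * y))))
         \o leg13 (trl e (Up x))
         \o leg12 (tr_full e (invop (Rm (x / y)))))) :
  let T := transfer e Up Um in
  forall x y : R[i], dom T x -> dom T y ->
    mval T x \o mval T y =1 mval T y \o mval T x.
Proof.
move=> T x y; apply: mval_commute.
have [/Mer_densely_linear lR /generic1_densely bR] := hR.
have [_ /generic1_densely bRt] := hRt.
(* The maps y |-> y and y |-> 1 / y serve in [densely_mul] to reach the arguments x * y and x / y of
   R. *)
have cid (z : [the numFieldType of R[i]]) :
  z != 0 -> z != 0 /\ {for z, continuous id}.
  by move=> z0; split=> //; exact: cvg_id.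
have cinv (z : [the numFieldType of R[i]]) : z != 0 ->
    z^-1 != 0 /\ {for z, continuous (@GRing.inv [the numFieldType of R[i]])}.
  by move=> z0; split; [rewrite invr_eq0|exact: inv_continuous].
have hU := densely_and (Mer_densely_linear hUp) (Mer_densely_linear hUm).
(* All the premises of [transfer_commute] at once: R must be invertible at x / y, and its partial
   transpose at x * y. *)
have h := densely2_and (densely2_and (densely_left hU) (densely_right hU))
  (densely2_and (densely2_and (densely_mul cinv (densely_and lR bR))
    (densely_mul cid (densely_and lR bRt)))
     (densely2_and (generic2_densely right_reflection) (generic2_densely
       dual_reflection))).
move=> U' V' oU U0 oV V0.
have [U1 [V1 [hU1 hV1 UU VV P]]] := h U' V' oU U0 oV V0.
exists U1, V1; split=> // a b Ua Vb.
have [[[lX lA] [lY lB]] [[[lS bS] [lM bM]] [re dre]]] := P a b Ua Vb.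
exact: (transfer_commute he lX lY lA lB lS lM bS bM re dre).
Qed.
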